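(* Let $C_{\rm equiv}>0$ be a constant, independent of $\alpha$, such that $\|v_h\|_h^2\le\frac{C_{\rm equiv}}{\alpha}\,s(v_h,v_h)$ for all $v_h\in V_{\mathcal P}$. Suppose that $\alpha\ge C_{\rm equiv}$. Then there exists $u_h\in V_{\mathcal P}$ such that $$a_J(u_h^+,v_h)+s(u_h^-,v_h)=\langle f,v_h\rangle_\Omega\qquad\forall\, v_h\in V_{\mathcal P}.$$
   Context: $\Omega\subset\mathbb R^d$ ($d=2,3$) is an open bounded Lipschitz domain with polyhedral boundary. $f\in H^{-1}(\Omega)$, and $\langle\cdot,\cdot\rangle_\Omega$ is the duality pairing between $H^{-1}(\Omega)$ and $H^1_0(\Omega)$; $(\cdot,\cdot)_\Omega$ is the $L^2(\Omega)$ inner product. $\mathcal D=(d_{ij})\in L^\infty(\Omega)^{d\times d}$ is symmetric and there is $d_0>0$ with $\sum_{i,j}y_i d_{ij}(\boldsymbol x)y_j\ge d_0\sum_i y_i^2$ for all $y\in\mathbb R^d$ and a.e. $\boldsymbol x\in\Omega$. $\boldsymbol\beta\in L^\infty(\Omega)^d$ with $\mathrm{div}\,\boldsymbol\beta=0$, $\mu>0$ and $\kappa>0$ are constants. $a(w,v)=(\mathcal D\nabla w,\nabla v)_\Omega+(\boldsymbol\beta\cdot\nabla w,v)_\Omega+(\mu w,v)_\Omega$. $\|\cdot\|_{0,G}$ and $\|\cdot\|_{0,\infty,G}$ are the $L^2(G)$ and $L^\infty(G)$ norms. $\boldsymbol\beta$ is understood to be regular enough that its restrictions to facets, and hence $\|\boldsymbol\beta\|_{0,\infty,F}$,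 make sense, with $\|\boldsymbol\beta\|_{0,\infty,F}\le\|\boldsymbol\beta\|_{0,\infty,K}$ when $F$ is a facet of $K$. Mesh and spaces. $\mathcal P$ is a conforming, shape-regular, quasi-uniform partition of $\Omega$ into closed simplices (or affine quadrilaterals/hexahedra); $h_G$ is the diameter of $G$. For $k\ge1$, $V_{\mathcal P}=\{v_h\in C^0(\overline\Omega): v_h|_K\in\mathfrak R(K)\ \forall K\in\mathcal P\}\cap H^1_0(\Omega)$, where $\mathfrak R(K)=\mathbb P_k(K)$ (polynomials of total degree $\le k$) if $K$ is a simplex and $\mathfrak R(K)=\mathbb Q_k(K)$ (mapped polynomials of degree $\le k$ in each variable) if $K$ is an affine quadrilateral/hexahedron. $\boldsymbol x_1,\dots,\boldsymbol x_N$ are the internal Lagrange nodes, $\phi_1,\dots,\phi_N$ the corresponding Lagrange basis of $V_{\mathcal P}$, and $\omega_i=\bigcup\{K\in\mathcal P:\boldsymbol x_i\in K\}$. $\mathcal F_I$ is the set of internal facets, $\llbracket\cdot\rrbracket$ the jump across a facet. The mesh function $\mathfrak h$ is the continuous elementwise linear function (multilinear on quadrilaterals/hexahedra) whose value at each mesh vertex $\boldsymbol v$ is the arithmetic mean of $h_K$ over the elements $K\ni\boldsymbol v$. Projection. For $v_h\in V_{\mathcal P}$, $v_h^+=\sum_{i=1}^N\max\{0,\min\{v_h(\boldsymbol x_i),\kappa\}\}\phi_i$ and $v_h^-=v_h-v_h^+$. Forms and norm. With a fixed constant $\gamma\ge0$, $J(u_h,v_h)=\gamma\sum_{F\in\mathcal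 F_I}\int_F\|\boldsymbol\beta\|_{0,\infty,F}h_F^2\,\llbracket\nabla u_h\rrbracket\cdot\llbracket\nabla v_h\rrbracket\,ds$ and $a_J(u_h,v_h)=a(u_h,v_h)+J(u_h,v_h)$. With a constant $\alpha>0$, $$s(v_h,w_h)=\alpha\sum_{i=1}^N\left(\|\mathcal D\|_{0,\infty,\omega_i}\mathfrak h(\boldsymbol x_i)^{d-2}+\|\boldsymbol\beta\|_{0,\infty,\omega_i}\mathfrak h(\boldsymbol x_i)^{d-1}+\mu\,\mathfrak h(\boldsymbol x_i)^d\right)v_h(\boldsymbol x_i)w_h(\boldsymbol x_i).$$ The norm is $\|v_h\|_h=\left(\|\mathcal D^{1/2}\nabla v_h\|_{0,\Omega}^2+\|\mu^{1/2}v_h\|_{0,\Omega}^2+J(v_h,v_h)\right)^{1/2}$. *)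

(* Defs.v *)
From HB Require Import structures.
From mathcomp Require Import all_boot all_order all_algebra.
From mathcomp Require Import all_classical all_reals all_analysis.
Set Implicit Arguments.
Unset Strict Implicit.
Unset Printing Implicit Defensive.
Import Order.TTheory GRing.Theory Num.Theory.
Import numFieldNormedType.Exports.
Local Open Scope classical_set_scope.
Local Open Scope ring_scope.

(* Points of R^n are row vectors, with the product Borel sigma-algebra (the
   analogue of the library's instance on n.-tuple T). *)
Definition measure_row_display : measure_display -> measure_display.
Proof. exact. Qed.

Section measurable_row.
Context {d} {T : measurableType d} (n : nat).

Let coors : 'I_n -> 'rV[T]_n -> T := fun i x => x ord0 i.

Let row_set0 : g_sigma_preimage coors set0.
Proof. exact: sigma_algebra0. Qed.

Let row_setC A : g_sigma_preimage coors A -> g_sigma_preimage coors (~` A).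
Proof. exact: sigma_algebraC. Qed.

Let row_bigcup (F : _^nat) : (forall i, g_sigma_preimage coors (F i)) ->
  g_sigma_preimage coors (\bigcup_i (F i)).
Proof. exact: sigma_algebra_bigcup. Qed.

HB.instance Definition _ := @isMeasurable.Build (measure_row_display d)
  'rV[T]_n (g_sigma_preimage coors) row_set0 row_setC row_bigcup.

End measurable_row.

Lemma measurable_row_coord {d} {T : measurableType d} n (i : 'I_n) :
  measurable_fun [set: 'rV[T]_n] (fun x => x ord0 i).
Proof.
move=> _ Y mY; rewrite setTI; apply: sub_sigma_algebra => /=.
rewrite -bigcup_seq/=; exists i => /=; first by rewrite mem_index_enum.
by exists Y => //; rewrite setTI.
Qed.

Lemma measurable_fun_row {d1 d2} {T1 : measurableType d1}
    {T2 : measurableType d2} n (f : T1 -> 'rV[T2]_n) :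
  (forall i, measurable_fun setT (fun x => f x ord0 i)) ->
  measurable_fun setT f.
Proof.
move=> mf.
have pref : g_sigma_preimage (fun i x => f x ord0 i) `<=` measurable.
  apply: smallest_sub; first exact: sigma_algebra_measurable.
  case: n => [|n] in f mf *; first by rewrite big_ord0.
  rewrite -bigcup_mkord_ord; apply: bigcup_sub => i Ii.
  by move=> A [B mB <-]; exact: mf.
rewrite (_ : (fun i x => _) = (fun i => (fun y : 'rV[T2]_n => y ord0 i) \o f)) //
  in pref.
rewrite g_sigma_preimage_comp in pref.
by move=> _ A mA; apply: pref; exists A.
Qed.

Section lebesgue_row.
Context {R : realType}.

Definition row_cons n (p : measurableTypeR R * 'rV[R]_n) : 'rV[R]_n.+1 :=
  \row_(i < n.+1) if unlift ord0 i is Some j then p.2 ord0 j else p.1.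

Definition row_uncons n (x : 'rV[R]_n.+1) : measurableTypeR R * 'rV[R]_n :=
  (x ord0 ord0, \row_(j < n) x ord0 (lift ord0 j)).

Lemma row_consK n : cancel (@row_cons n) (@row_uncons n).
Proof.
case=> a v; rewrite /row_uncons !mxE unlift_none; congr (_, _).
by apply/rowP => j; rewrite !mxE liftK.
Qed.

Lemma measurable_row_cons n : measurable_fun setT (@row_cons n).
Proof.
apply: measurable_fun_row => i.
rewrite (_ : (fun x => _) = fun p : measurableTypeR R * 'rV[R]_n =>
   if unlift ord0 i is Some j then p.2 ord0 j else p.1 :> R); last first.
  by apply/funext => p; rewrite mxE.
case: (unlift ord0 i) => [j|]; last exact: measurable_fst.
apply: (measurableT_comp (@measurable_row_coord _ R n j)).
exact: measurable_snd.
Qed.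

Lemma measurable_row_uncons n : measurable_fun setT (@row_uncons n).
Proof.
apply: measurable_fun_pair; first exact: (@measurable_row_coord _ R).
apply: measurable_fun_row => i.
rewrite (_ : (fun x => _) = fun x : 'rV[R]_n.+1 => x ord0 (lift ord0 i)).
  exact: (@measurable_row_coord _ R).
by apply/funext => x; rewrite mxE.
Qed.

Section step.
Context (n : nat) (m : {sigma_finite_measure set 'rV[R]_n -> \bar R}).

Definition leb_cons : set 'rV[R]_n.+1 -> \bar R :=
  pushforward (@lebesgue_measure R \x m)%E (@row_cons n).

Let mu : {measure set (measurableTypeR R * 'rV[R]_n)%type -> \bar R} :=
  (@lebesgue_measure R \x m)%E.
Let mu_cons : {measure set 'rV[R]_n.+1 -> \bar R} :=
  measure_function_pushforward__canonical__measure_function_Measure mu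
    (@measurable_row_cons n).

HB.instance Definition _ := isMeasure.Build _ _ _ leb_cons
  (measure0 mu_cons) (measure_ge0 mu_cons)
  (@measure_semi_sigma_additive _ _ _ mu_cons).

Let leb_cons_sigma_finite : sigma_finite setT leb_cons.
Proof.
have /sigma_finiteP[F [TF ndF Foo]] := sigma_finiteT (@lebesgue_measure R).
have /sigma_finiteP[G [TG ndG Goo]] := sigma_finiteT m.
exists (fun i => @row_uncons n @^-1` (F i `*` G i)).
  apply/esym; rewrite -subTset => x _; set y := row_uncons x.
  have [i _ Fi] : (\bigcup_i F i) y.1 by rewrite -TF.
  have [j _ Gj] : (\bigcup_i G i) y.2 by rewrite -TG.
  exists (maxn i j) => //; split => /=.
    exact: (subsetPset _ _ (ndF _ _ (leq_maxl i j))) Fi.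
  exact: (subsetPset _ _ (ndG _ _ (leq_maxr i j))) Gj.
move=> i; have [mFi Fioo] := Foo i; have [mGi Gioo] := Goo i; split.
  rewrite -[X in measurable X]setTI; apply: measurable_row_uncons => //.
  exact: measurableX.
rewrite /leb_cons /pushforward -comp_preimage.
rewrite (_ : _ \o _ = id); last by apply/funext => x; exact: row_consK.
by rewrite preimage_id product_measure1E// lte_mul_pinfty// ge0_fin_numE.
Qed.

HB.instance Definition _ :=
  Measure_isSigmaFinite.Build _ _ _ leb_cons leb_cons_sigma_finite.

End step.

Definition leb0 : probability 'rV[R]_0 R := \d_ (0 : 'rV[R]_0).

(* n-dimensional Lebesgue measure (on Borel sets); see leb_box. *)
Fixpoint leb n : {sigma_finite_measure set 'rV[R]_n -> \bar R} :=
  if n is m.+1 then leb_cons (leb m) else leb0.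

End lebesgue_row.

Lemma leb_box {R : realType} n (A : 'I_n -> set (measurableTypeR R)) :
  (forall i, measurable (A i)) ->
  (leb n [set x : 'rV[R]_n | forall i, A i (x ord0 i)] =
   \prod_(i < n) lebesgue_measure (A i))%E.
Proof.
elim: n A => [|n IHn] A mA.
  rewrite big_ord0 /= diracE mem_set //= => -[].
  by case.
rewrite big_ord_recl -(IHn (fun i => A (lift ord0 i)))//.
have mB : measurable [set x : 'rV[R]_n | forall i, A (lift ord0 i) (x ord0 i)].
  rewrite (_ : [set x | _] =
      \bigcap_(i in [set: 'I_n]) ((fun x : 'rV[R]_n => x ord0 i) @^-1` A (lift ord0 i))).
    apply: fin_bigcap_measurable => // i _.
    rewrite -[X in measurable X]setTI.
    exact: (@measurable_row_coord _ R n i measurableT _ (mA (lift ord0 i))).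
  by apply/seteqP; split => [x xA i _|x xA i]; [exact: xA|exact: xA].
rewrite -product_measure1E//= /leb_cons /pushforward.
congr (product_measure1 _ _ _); apply/seteqP; split => -[a v] /=.
  move=> H; split; first by move: (H ord0); rewrite mxE unlift_none.
  by move=> i; move: (H (lift ord0 i)); rewrite mxE liftK.
move=> [/= Aa Av] i; rewrite mxE.
by case: unliftP => [j ->|->].
Qed.

Section euclidean.
Context {R : realType} {d : nat}.
Implicit Types (x y : 'rV[R]_d) (A : 'M[R]_d) (S : set 'rV[R]_d).

Definition dotv x y : R := \sum_i x ord0 i * y ord0 i.

(* The library norm `|x| on 'rV[R]_d is the max norm. *)
Definition enorm x : R := Num.sqrt (dotv x x).

Definition diam S : R := sup [set enorm (x - y) | x in S & y in S].

(* The column A y, for y stored as a row. *)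
Definition mulv A y : 'rV[R]_d := y *m A^T.

Definition opnorm A : R := sup [set enorm (mulv A y) | y in [set y | enorm y <= 1]].

(* A^{1/2}, for A symmetric positive semidefinite. *)
Definition sqrtmx A : 'M[R]_d :=
  xget 0 [set B | [/\ B^T = B, forall y, 0 <= dotv y (mulv B y) & B *m B = A]].

Definition boundary S : set 'rV[R]_d := closure S `\` interior S.

Definition conv_hull m (p : 'I_m -> 'rV[R]_d) : set 'rV[R]_d :=
  [set x | exists c : 'I_m -> R,
    [/\ forall i, 0 <= c i, \sum_i c i = 1 & x = \sum_i c i *: p i]].

Definition polyhedral_boundary S : Prop :=
  exists (n : nat) (F : 'I_n -> set 'rV[R]_d),
    boundary S = \bigcup_(i in [set: 'I_n]) F i /\
    forall i,
      (exists (m : nat) (p : 'I_m -> 'rV[R]_d), F i = conv_hull p) /\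
      (exists (nu : 'rV[R]_d) (c : R),
         nu != 0 /\ F i `<=` [set x | dotv x nu = c]).

(* Near each boundary point, S is the strict epigraph, in some unit direction
   nu, of a Lipschitz function g of the component orthogonal to nu. *)
Definition lipschitz_boundary S : Prop :=
  forall z, boundary S z ->
  exists (r L : R) (nu : 'rV[R]_d) (g : 'rV[R]_d -> R),
    [/\ 0 < r, enorm nu = 1,
        forall x t, g (x + t *: nu) = g x,
        forall x y, `|g x - g y| <= L * enorm (x - y) &
        forall y, enorm (y - z) < r -> (S y <-> g y < dotv y nu)].

Definition lipschitz_polyhedral_domain S : Prop :=
  [/\ open S /\ connected S, S !=set0, bounded_set S,
      lipschitz_boundary S & polyhedral_boundary S].

End euclidean.

Section sobolev.
Context {R : realType} {d : nat}.
Implicit Types (G Omega : set 'rV[R]_d) (v w : 'rV[R]_d -> R)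
  (g : 'rV[R]_d -> 'rV[R]_d).

Definition inL G (p : \bar R) v : Prop := (v \_ G) \in Lfun (leb d) p.

(* Norm of L^p(G); the norm of a vector or matrix field is that of its pointwise
   Euclidean or spectral norm. *)
Definition normL G (p : \bar R) v : R :=
  fine ('N[leb d]_p[EFin \o (v \_ G)])%E.

Definition ip G v w : R := \int[leb d]_(x in G) (v x * w x).

Definition partial (i : 'I_d) v : 'rV[R]_d -> R :=
  fun x => 'D_(delta_mx ord0 i) v x.

Definition smooth v : Prop :=
  forall (s : seq 'I_d), let w := foldr partial v s in
    continuous w /\ forall i x, derivable w x (delta_mx ord0 i).

(* C_c^oo(Omega), as functions on the whole space *)
Definition test_fun Omega v : Prop :=
  [/\ smooth v, compact (closure [set x | v x != 0]) &
      closure [set x | v x != 0] `<=` Omega].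

(* g is the weak gradient in L^2(Omega)^d of v in L^2(Omega). *)
Definition is_weak_grad Omega v g : Prop :=
  [/\ inL Omega 2%:E v, forall i, inL Omega 2%:E (fun x => g x ord0 i) &
      forall psi, test_fun Omega psi -> forall i,
        ip Omega v (partial i psi) = - ip Omega (fun x => g x ord0 i) psi].

(* H^1_0(Omega), the closure of C_c^oo(Omega) in H^1(Omega): v has weak gradient
   g, and (v, g) is an L^2-limit of test functions with their classical
   gradients. *)
Definition is_H10_grad Omega v g : Prop :=
  is_weak_grad Omega v g /\ exists psi : nat -> 'rV[R]_d -> R,
    [/\ forall n, test_fun Omega (psi n),
        normL Omega 2%:E (fun x => psi n x - v x) @[n --> \oo] --> (0 : R) &
        forall i, normL Omega 2%:E
          (fun x => partial i (psi n) x - g x ord0 i) @[n --> \oo] --> (0 : R)].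

Definition H10 Omega v : Prop := exists g, is_H10_grad Omega v g.

(* A representative of the weak gradient of v in H^1_0(Omega). Weak gradients
   being unique up to null sets, is_weak_grad would select the same class. *)
Definition grad Omega v : 'rV[R]_d -> 'rV[R]_d :=
  xget (fun=> 0) [set g | is_H10_grad Omega v g].

Definition normH1 Omega v : R :=
  Num.sqrt (normL Omega 2%:E v ^+ 2 +
            normL Omega 2%:E (fun x => enorm (grad Omega v x)) ^+ 2).

(* Bounded linear functionals on H^1_0(Omega); the pairing <f, v> is f v. *)
Definition Hm1 Omega (f : ('rV[R]_d -> R) -> R) : Prop :=
  (forall (c : R) v w, H10 Omega v -> H10 Omega w ->
     f (fun x => c * v x + w x) = c * f v + f w) /\
  exists C : R, forall v, H10 Omega v -> `|f v| <= C * normH1 Omega v.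

Definition div_free Omega g : Prop :=
  forall psi, test_fun Omega psi ->
    \int[leb d]_(x in Omega)
      dotv (g x) (\row_i partial i psi x) = 0.

End sobolev.

Section reference_element.
Context {R : realType}.

(* The unit simplex (s = true) or the unit cube (s = false) of R^n *)
Definition ref_dom {n} (s : bool) : set 'rV[R]_n :=
  [set t : 'rV[R]_n | (forall i, 0 <= t ord0 i) /\
     if s return Prop then \sum_i t ord0 i <= 1 else forall i, t ord0 i <= 1].

Definition poly_eval n k (c : {ffun 'I_n -> 'I_k.+1} -> R) (t : 'rV[R]_n) : R :=
  \sum_(m : {ffun 'I_n -> 'I_k.+1}) c m * \prod_i t ord0 i ^+ m i.

(* Polynomials of total degree at most k *)
Definition poly_total n k (p : 'rV[R]_n -> R) : Prop :=
  exists c : {ffun 'I_n -> 'I_k.+1} -> R,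
    (forall m : {ffun 'I_n -> 'I_k.+1}, (k < \sum_i m i)%N -> c m = 0) /\
    p = poly_eval c.

(* Polynomials of degree at most k in each variable *)
Definition poly_partial n k (p : 'rV[R]_n -> R) : Prop :=
  exists c : {ffun 'I_n -> 'I_k.+1} -> R, p = poly_eval c.

End reference_element.

(* The closed cell is the image of the unit simplex or cube under the affine
   bijection t |-> elt_orig + t *m elt_frame. *)
Record element (R : realType) (d : nat) := Element {
  is_simplex : bool;
  elt_orig : 'rV[R]_d;
  elt_frame : 'M[R]_d;
  elt_frame_unit : elt_frame \in unitmx }.

Section mesh.
Context {R : realType} {d : nat}.
Implicit Types (K : element R d) (A F : set 'rV[R]_d) (v w : 'rV[R]_d -> R).

Definition elt_map K (t : 'rV[R]_d) : 'rV[R]_d := elt_orig K + t *m elt_frame K.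

Definition cell K : set 'rV[R]_d := elt_map K @` ref_dom (is_simplex K).

Definition vertices K : set 'rV[R]_d :=
  elt_map K @` (ref_dom (is_simplex K) `&`
    [set t | forall i, t ord0 i = 0 \/ t ord0 i = 1]).

(* The principal lattice of order k on a simplex, the equispaced tensor grid
   with k + 1 points per direction on a parallelotope *)
Definition nodes k K : set 'rV[R]_d :=
  elt_map K @` (ref_dom (is_simplex K) `&`
    [set t | forall i, exists m : nat, t ord0 i = m%:R / k%:R]).

(* v|_K belongs to P_k(K) or to the mapped Q_k(K). *)
Definition local_space k K v : Prop :=
  if is_simplex K then
    exists2 p, poly_total k p & forall x, cell K x -> v x = p x
  else
    exists2 p, poly_partial k p &
      forall t, ref_dom (is_simplex K) t -> v (elt_map K t) = p t.

(* Nonempty faces of a convex polytope A (A included) *)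
Definition is_face F A : Prop :=
  exists l : 'rV[R]_d,
    F = [set x | A x /\ forall y, A y -> dotv l y <= dotv l x].

(* Affine parametrizations t |-> o + t *m B of a (d-1)-dimensional simplex or
   parallelotope by ref_dom s *)
Definition chart : Type := (bool * ('rV[R]_d * 'M[R]_(d.-1, d)))%type.

Definition chart_map (c : chart) (t : 'rV[R]_d.-1) : 'rV[R]_d :=
  c.2.1 + t *m c.2.2.

Definition is_chart F (c : chart) : Prop :=
  row_free c.2.2 /\ F = chart_map c @` ref_dom c.1.

Definition chart_of F : chart := xget (true, (0, 0)) [set c | is_chart F c].

Definition is_facet F A : Prop := is_face F A /\ exists c, is_chart F c.

(* Surface integral: Gram determinant of the chart times a (d-1)-dimensional
   Lebesgue integral. It does not depend on the chart. *)
Definition surf_int F (g : 'rV[R]_d -> R) : R :=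
  let c := chart_of F in
  Num.sqrt (\det (c.2.2 *m c.2.2^T)) *
  \int[leb d.-1]_(t in ref_dom c.1) g (chart_map c t).

(* L^oo(F) and its norm for the surface measure *)
Definition inLoo_facet F (g : 'rV[R]_d -> R) : Prop :=
  inL (ref_dom (chart_of F).1) +oo%E (g \o chart_map (chart_of F)).

Definition normLoo_facet F (g : 'rV[R]_d -> R) : R :=
  normL (ref_dom (chart_of F).1) +oo%E (g \o chart_map (chart_of F)).

(* Trace at x, from inside K, of the elementwise gradient of v *)
Definition trace_grad v K (x : 'rV[R]_d) : 'rV[R]_d :=
  \row_i lim (partial i v y @[y --> within (interior (cell K)) (nbhs x)]).

Definition inball_diam A : R :=
  sup [set 2 * r | r in
    [set r : R | 0 <= r /\ exists x, [set y | enorm (y - x) <= r] `<=` A]].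

Section partition.
Context (Omega : set 'rV[R]_d) {M : nat} (T : 'I_M -> element R d).

Definition conforming_partition : Prop :=
  [/\ closure Omega = \bigcup_(i in [set: 'I_M]) cell (T i),
      forall i j, i != j ->
        interior (cell (T i)) `&` interior (cell (T j)) = set0 &
      forall i j, i != j ->
        cell (T i) `&` cell (T j) = set0 \/
        (is_face (cell (T i) `&` cell (T j)) (cell (T i)) /\
         is_face (cell (T i) `&` cell (T j)) (cell (T j)))].

Definition shape_regular (sigma : R) : Prop :=
  forall i, diam (cell (T i)) <= sigma * inball_diam (cell (T i)).

Definition quasi_uniform (tau : R) : Prop :=
  forall i j, diam (cell (T i)) <= tau * diam (cell (T j)).

(* Functions on the closure of Omega are total functions whose values elsewhere
   are irrelevant. *)
Definition VP k v : Prop :=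
  [/\ {within closure Omega, continuous v},
      forall i, local_space k (T i) v & H10 Omega v].

Definition internal_nodes k N (x : 'I_N -> 'rV[R]_d) : Prop :=
  injective x /\
  range x = Omega `&` \bigcup_(i in [set: 'I_M]) nodes k (T i).

Definition lagrange_basis k N (x : 'I_N -> 'rV[R]_d)
    (phi : 'I_N -> 'rV[R]_d -> R) : Prop :=
  [/\ forall i, VP k (phi i),
      forall i j, phi i (x j) = (i == j)%:R &
      forall v, VP k v -> exists c : 'I_N -> R,
        forall y, closure Omega y -> v y = \sum_i c i * phi i y].

Definition patch_of (z : 'rV[R]_d) : set 'rV[R]_d :=
  \bigcup_(i in [set i | cell (T i) z]) cell (T i).

Definition mesh_function (hh : 'rV[R]_d -> R) : Prop :=
  [/\ {within closure Omega, continuous hh},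
      forall i, local_space 1 (T i) hh &
      forall i z, vertices (T i) z ->
        hh z = (\sum_(j < M | `[< cell (T j) z >]) diam (cell (T j))) /
               (\sum_(j < M | `[< cell (T j) z >]) 1)].

(* With i < j, each internal facet cell (T i) `&` cell (T j) occurs once. *)
Definition internal_facet (i j : 'I_M) : Prop :=
  is_facet (cell (T i) `&` cell (T j)) (cell (T i)) /\
  is_facet (cell (T i) `&` cell (T j)) (cell (T j)).

Definition jump_grad (i j : 'I_M) v (x : 'rV[R]_d) : 'rV[R]_d :=
  trace_grad v (T i) x - trace_grad v (T j) x.

Section forms.
Context (D : 'rV[R]_d -> 'M[R]_d) (beta : 'rV[R]_d -> 'rV[R]_d) (mu gamma : R).

Definition form_a w v : R :=
  \int[leb d]_(x in Omega) dotv (mulv (D x) (grad Omega w x)) (grad Omega v x) +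
  ip Omega (fun x => dotv (beta x) (grad Omega w x)) v +
  ip Omega (fun x => mu * w x) v.

Definition form_J u v : R :=
  gamma * \sum_(i < M) \sum_(j < M | (i < j)%N && `[< internal_facet i j >])
    let F := cell (T i) `&` cell (T j) in
    surf_int F (fun x => normLoo_facet F (fun y => enorm (beta y)) *
      diam F ^+ 2 * dotv (jump_grad i j u x) (jump_grad i j v x)).

Definition form_aJ u v : R := form_a u v + form_J u v.

Definition form_s (alpha : R) (hh : 'rV[R]_d -> R) N (x : 'I_N -> 'rV[R]_d)
    v w : R :=
  alpha * \sum_(i < N)
    (normL (patch_of (x i)) +oo%E (fun y => opnorm (D y)) * hh (x i) ^+ (d - 2)%N +
     normL (patch_of (x i)) +oo%E (fun y => enorm (beta y)) * hh (x i) ^+ (d - 1)%N +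
     mu * hh (x i) ^+ d) * v (x i) * w (x i).

Definition norm_h v : R :=
  Num.sqrt
    (normL Omega 2%:E (fun x => enorm (mulv (sqrtmx (D x)) (grad Omega v x))) ^+ 2 +
     normL Omega 2%:E (fun x => Num.sqrt mu * v x) ^+ 2 +
     form_J v v).

End forms.
End partition.

Definition pos_part (kappa : R) N (x : 'I_N -> 'rV[R]_d)
    (phi : 'I_N -> 'rV[R]_d -> R) v : 'rV[R]_d -> R :=
  fun y => \sum_(i < N) Num.max 0 (Num.min (v (x i)) kappa) * phi i y.

Definition neg_part (kappa : R) N (x : 'I_N -> 'rV[R]_d)
    (phi : 'I_N -> 'rV[R]_d -> R) v : 'rV[R]_d -> R :=
  fun y => v y - pos_part kappa x phi v y.

End mesh.

(* Main.v *)
(* The form a_J is linear in u^+, and the nodal vector of u^+ is the projection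
   P(U) of the nodal vector U of u onto the box [0, kappa]^N. With
   A_ij = a_J(phi_j, phi_i), S the diagonal matrix of the stabilization and
   b_i = <f, phi_i>, the scheme reads A P(U) + S (U - P(U)) = b. Since S is
   diagonal and positive, this amounts to the variational inequality on the box
   for p = P(U): find p with p = P(p - rho (A p - b)), and set
   U = p + S^-1 (b - A p). As A is positive definite, p |-> P(p - rho (A p - b))
   is strictly distance-decreasing for small rho and has a fixed point in the
   compact box, so that no topological fixed point theorem is needed.
   Positive definiteness comes from the ellipticity of D, the skew-symmetry of
   the convection term and J >= 0; the weak gradient being determined up to null
   sets only, the bilinearity of a is read off from L^2 norms. *)

Require Import Defs.
From mathcomp Require Import all_boot all_order all_algebra.
From mathcomp Require Import all_classical all_reals all_analysis.
From mathcomp Require Import measurable_realfun ess_sup_inf ring lra.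
Import Order.TTheory GRing.Theory Num.Theory.
Import numFieldNormedType.Exports.
Set Implicit Arguments.
Unset Strict Implicit.
Unset Printing Implicit Defensive.
Local Open Scope classical_set_scope.
Local Open Scope ring_scope.

(** Functions are total, while the mathematics sees them only on Omega or on its closure: [grad]
    picks an arbitrary representative, expansions in the Lagrange basis hold on the closure only,
    and [f] acts on total functions. Linearity is therefore always stated for a z that agrees with c
    v + w on the relevant set. For a and f it rests on one fact: an H^1_0 function vanishing on
    Omega has a gradient of zero L^2 norm, and bounded forms ignore such arguments. For J it rests
    on polynomials: on each cell a discrete function equals a polynomial, whose gradient is the
    one-sided trace.

    Passing from the common step rho to the diagonal S^-1 is possible because the box is a product
    of intervals: its normal cone splits by coordinates, and each coordinate condition is unchanged
    by any positive step of its own.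

    Strict positivity of A is read off from the reaction term mu |v|^2: a nonzero combination of
    basis functions is nonzero at some node inside Omega, hence, being continuous, on a set of
    positive measure. *)

Lemma cvg_sumr {R : realType} {T I : Type} (F : set_system T) {FF : Filter F}
    (r : seq I) (P : pred I) (f : I -> T -> R) (l : I -> R) :
  (forall i, P i -> f i x @[x --> F] --> l i) ->
  \sum_(i <- r | P i) f i x @[x --> F] --> \sum_(i <- r | P i) l i.
Proof. by move=> h; apply: cvg_big => //; exact: (@add_continuous R^o). Qed.

Lemma continuous_sumr {R : realType} {T : topologicalType} {I : Type}
    (r : seq I) (P : pred I) (f : I -> T -> R) :
  (forall i, P i -> continuous (f i)) ->
  continuous (fun x => \sum_(i <- r | P i) f i x).
Proof. by move=> cf x; apply: cvg_sumr => i Pi; exact: cf. Qed.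

Lemma continuous_mulr {R : realType} {T : topologicalType} (f g : T -> R) :
  continuous f -> continuous g -> continuous (fun x => f x * g x).
Proof. by move=> cf cg x; apply: cvgM; [exact: cf|exact: cg]. Qed.

Lemma continuous_addr {R : realType} {T : topologicalType} (f g : T -> R) :
  continuous f -> continuous g -> continuous (fun x => f x + g x).
Proof. by move=> cf cg x; apply: cvgD; [exact: cf|exact: cg]. Qed.

Lemma continuous_subr {R : realType} {T : topologicalType} (f g : T -> R) :
  continuous f -> continuous g -> continuous (fun x => f x - g x).
Proof. by move=> cf cg x; apply: cvgB; [exact: cf|exact: cg]. Qed.

Lemma continuous_cstr {R : realType} {T : topologicalType} (a : R) :
  continuous (fun _ : T => a).
Proof. by move=> x; exact: cvg_cst. Qed.

Lemma continuous_coord {R : realType} {n : nat} (i : 'I_n) :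
  continuous (fun x : 'rV[R]_n => x ord0 i).
Proof. exact: coord_continuous. Qed.

(** * The truncated algebraic system *)

Section dotv_theory.
Context {R : realType} {n : nat}.
Implicit Types x y z : 'rV[R]_n.

Lemma dotvC x y : dotv x y = dotv y x.
Proof. by apply: eq_bigr => i _; rewrite mulrC. Qed.

Lemma dotvDl x y z : dotv (x + y) z = dotv x z + dotv y z.
Proof. by rewrite -big_split; apply: eq_bigr => i _; rewrite mxE mulrDl. Qed.

Lemma dotvZl (a : R) x y : dotv (a *: x) y = a * dotv x y.
Proof. by rewrite mulr_sumr; apply: eq_bigr => i _; rewrite mxE mulrA. Qed.

Lemma dotvDr x y z : dotv z (x + y) = dotv z x + dotv z y.
Proof. by rewrite dotvC dotvDl !(dotvC z). Qed.

Lemma dotvZr (a : R) x y : dotv y (a *: x) = a * dotv y x.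
Proof. by rewrite dotvC dotvZl (dotvC y). Qed.

Lemma dotv_ge0 x : 0 <= dotv x x.
Proof. by apply: sumr_ge0 => i _; rewrite -expr2 sqr_ge0. Qed.

Lemma dotv_eq0 x : dotv x x = 0 -> x = 0.
Proof.
move=> x0; apply/rowP => i; rewrite mxE; apply/eqP; rewrite -sqrf_eq0 expr2.
by apply/eqP; apply: (psumr_eq0P _ x0) => // j _; rewrite -expr2 sqr_ge0.
Qed.

Lemma dotv_gt0 x : x != 0 -> 0 < dotv x x.
Proof.
by move=> x0; rewrite lt_neqAle dotv_ge0 andbT eq_sym; apply: contra_neq x0 => /dotv_eq0.
Qed.

Lemma coord_sqr_le x i : x ord0 i ^+ 2 <= dotv x x.
Proof.
rewrite /dotv (bigD1 i) //= -expr2 lerDl.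
by apply: sumr_ge0 => j _; rewrite -expr2 sqr_ge0.
Qed.

Lemma continuous_dotv (T : topologicalType) (f g : T -> 'rV[R]_n) :
  (forall i, continuous (fun t => f t ord0 i)) ->
  (forall i, continuous (fun t => g t ord0 i)) ->
  continuous (fun t => dotv (f t) (g t)).
Proof. by move=> cf cg t; apply: cvg_sumr => i _; apply: cvgM; [exact: cf|exact: cg]. Qed.

Lemma compact_sphere : compact [set x : 'rV[R]_n | dotv x x = 1].
Proof.
apply: bounded_closed_compact.
  exists 1; split; first exact: num_real.
  move=> y y1 x /= x1; rewrite /Num.norm /= mx_normrE.
  apply: bigmax_le => [|[a i] _ /=]; first exact: le_trans (ltW y1).
  rewrite (ord1 a) (le_trans _ (ltW y1))// -(@ler_pXn2r _ 2) ?nnegrE// expr1n.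
  by rewrite real_normK ?num_real// -x1; exact: coord_sqr_le.
have /continuous_closedP : continuous (fun x : 'rV[R]_n => dotv x x).
  by apply: continuous_dotv => i; exact: coord_continuous.
by move=> /(_ _ (@closed_eq R 1)).
Qed.

End dotv_theory.

Section truncated_system.
Context {R : realType}.
Implicit Types (kappa t : R).

Definition clip kappa t : R := Num.max 0 (Num.min t kappa).

(** The cases overlap and each carries two inequalities, so that the estimates below reduce to
    linear arithmetic case by case. *)
Lemma clip_cases kappa t : 0 < kappa ->
  [\/ [/\ t <= 0, t <= kappa & clip kappa t = 0],
     [/\ 0 <= t, t <= kappa & clip kappa t = t] |
     [/\ 0 <= t, kappa <= t & clip kappa t = kappa]].
Proof.
rewrite /clip => k0; case: (leP t kappa) => tk.
  case: (leP 0 t) => t0; first exact: Or32.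
  by apply: Or31; split=> //; exact: ltW.
by apply: Or33; split; [lra|exact: ltW|rewrite max_r// ltW].
Qed.

Lemma clip_itv kappa t : 0 < kappa -> 0 <= clip kappa t <= kappa.
Proof.
by move=> k0; case: (clip_cases t k0) => -[h g ->]; apply/andP; split; lra.
Qed.

Lemma clip_nonexpansive kappa s t : 0 < kappa ->
  (clip kappa s - clip kappa t) ^+ 2 <= (s - t) ^+ 2.
Proof.
move=> k0; rewrite -(real_normK (num_real (_ - clip _ _))) -(real_normK (num_real (s - t))).
rewrite ler_sqr ?nnegrE//.
by case: (clip_cases s k0) => -[h1 h2 ->]; case: (clip_cases t k0) => -[h3 h4 ->];
  rewrite ler_norml; apply/andP; split; case: (lerP s t) => ?; lra.
Qed.

(* Both equations say that r lies in the normal cone of [0, kappa] at p. *)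
Lemma clip_rescale kappa (p r a b : R) : 0 < kappa -> 0 < a -> 0 < b ->
  clip kappa (p + a * r) = p -> clip kappa (p + b * r) = p.
Proof.
move=> k0 a0 b0 pE; have := clip_itv (p + a * r) k0; rewrite pE => /andP[p0 pk].
have [r0|r0|r0] := ltrgtP r 0; last by move: pE; rewrite r0 !mulr0.
- have ar : a * r < 0 by rewrite pmulr_rlt0.
  have br : b * r < 0 by rewrite pmulr_rlt0.
  by move: pE; case: (clip_cases (p + a * r) k0) => -[h g ->] pE;
    case: (clip_cases (p + b * r) k0) => -[h' g' ->]; lra.
- have ar : 0 < a * r by rewrite pmulr_rgt0.
  have br : 0 < b * r by rewrite pmulr_rgt0.
  by move: pE; case: (clip_cases (p + a * r) k0) => -[h g ->] pE;
    case: (clip_cases (p + b * r) k0) => -[h' g' ->]; lra.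
Qed.

Lemma continuous_clip kappa : continuous (clip kappa).
Proof.
have cm : continuous (fun t : R => Num.min t kappa).
  move=> t; apply: (@continuous_min R R^o id (cst kappa) t); first exact: cvg_id.
  exact: cvg_cst.
move=> t; apply: (@continuous_max R R^o (cst 0) (fun t : R => Num.min t kappa) t); last exact: cm.
exact: cvg_cst.
Qed.

Lemma continuous_mulmx_coord n (B : 'M[R]_n) i :
  continuous (fun c : 'rV[R]_n => (c *m B) ord0 i).
Proof.
rewrite (_ : (fun _ => _) = fun c : 'rV[R]_n => \sum_j c ord0 j * B j i); last first.
  by apply/funext => c; rewrite mxE.
apply: continuous_sumr => j _.
by apply: continuous_mulr; [exact: continuous_coord|exact: continuous_cstr].
Qed.

(** By homogeneity it suffices to treat the unit sphere, where |x - rho x B|^2 = 1 - 2 rho q + rho^2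
    l. By compactness q = <x B, x> has a minimum m > 0 there, and l = |x B|^2 a maximum L. *)
Lemma pos_def_contraction n (B : 'M[R]_n) :
  (forall c, c != 0 -> 0 < dotv (c *m B) c) ->
  exists2 rho : R, 0 < rho & forall c, c != 0 ->
    dotv (c - rho *: (c *m B)) (c - rho *: (c *m B)) < dotv c c.
Proof.
(* In dimension 0 the sphere is empty and has no extremal points; the claim is then vacuous for any
   rho. *)
move=> Bpos; have [[c0 c00]|noc] := pselect (exists c : 'rV[R]_n, c != 0); last first.
  by exists 1 => // c c0; case: noc; exists c.
pose S := [set x : 'rV[R]_n | dotv x x = 1].
have scaleS c : c != 0 -> S ((Num.sqrt (dotv c c))^-1 *: c).
  move=> /dotv_gt0 cp; rewrite /S /= dotvZl dotvZr mulrA -invfM -expr2.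
  by rewrite sqr_sqrtr ?ltW// mulVf// gt_eqF.
have S0 : S !=set0 by exists ((Num.sqrt (dotv c0 c0))^-1 *: c0); exact: scaleS.
have cQ : continuous (fun c : 'rV[R]_n => dotv (c *m B) c).
  by apply: continuous_dotv => i; [exact: continuous_mulmx_coord|exact: continuous_coord].
have cL : continuous (fun c : 'rV[R]_n => dotv (c *m B) (c *m B)).
  by apply: continuous_dotv => i; exact: continuous_mulmx_coord.
have [a aS amin] := compact_EVT_min S0 compact_sphere (continuous_subspaceT cQ).
have [e eS emax] := compact_EVT_max S0 compact_sphere (continuous_subspaceT cL).
set m := dotv _ _ in amin; set L := dotv _ _ in emax.
have S_neq0 x : S x -> x != 0.
  by move=> /= Sx; apply: contra_eq_neq Sx => ->; rewrite -(scale0r 0) dotvZl mul0r eq_sym oner_eq0.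
have m0 : 0 < m by apply: Bpos; apply: S_neq0; exact/set_mem.
have L0 : 0 <= L by exact: dotv_ge0.
(* Then rho * L = m - rho < m <= q, whence rho * l < 2 * q. The added 1 keeps the denominator
   positive and the inequality strict. *)
pose rho := m / (L + 1).
have L1 : 0 < L + 1 by rewrite ltr_pwDr.
have rho0 : 0 < rho by rewrite divr_gt0.
exists rho => // c cn0; pose t := Num.sqrt (dotv c c).
have t0 : 0 < t by rewrite sqrtr_gt0 dotv_gt0.
pose x := t^-1 *: c.
have cE : c = t *: x by rewrite scalerA mulfV ?scale1r// gt_eqF.
have Sx : x \in S by apply/mem_set; exact: scaleS.
clearbody x.
rewrite {}cE -scalemxAl (scalerA rho) (mulrC rho) -scalerA -scalerBr.
rewrite !(dotvZl, dotvZr).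
rewrite ltr_pM2l// ltr_pM2l// -scaleNr !(dotvDl, dotvDr) !(dotvZl, dotvZr).
rewrite (dotvC x (x *m B)).
have := amin x Sx; have := emax x Sx.
set q := dotv _ x; set l := dotv _ (x *m B) => lL mq.
have rE : rho * (L + 1) = m by rewrite /rho divfK// gt_eqF.
have h1 : rho * l <= rho * L by rewrite ler_pM2l.
suff : rho * (rho * l) < rho * (2 * q) by lra.
rewrite ltr_pM2l//; lra.
Qed.

Lemma clip_system N (A : 'I_N -> 'I_N -> R) (s b : 'I_N -> R) kappa :
  0 < kappa -> (forall i, 0 < s i) ->
  (forall c : 'rV[R]_N, c != 0 ->
    0 < \sum_i \sum_j A i j * c ord0 j * c ord0 i) ->
  exists U : 'I_N -> R, forall i,
    \sum_j A i j * clip kappa (U j) + s i * (U i - clip kappa (U i)) = b i.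
Proof.
(* Vectors are rows acted on from the right, so [B] is the transpose of [A]. *)
move=> k0 s0 Apos; pose B := \matrix_(j, i) A i j : 'M[R]_N.
have BE (c : 'rV[R]_N) i : (c *m B) ord0 i = \sum_j A i j * c ord0 j.
  by rewrite mxE; apply: eq_bigr => j _; rewrite mxE mulrC.
have [c c0|rho rho0 contr] := @pos_def_contraction N B.
  rewrite /dotv; under eq_bigr do rewrite BE mulr_suml; exact: Apos.
pose G (p : 'rV[R]_N) : 'rV[R]_N :=
  \row_i clip kappa ((p - rho *: (p *m B)) ord0 i + rho * b i).
pose box := [set p : 'rV[R]_N | forall i, 0 <= p ord0 i <= kappa].
have Gbox p : box (G p) by move=> i; rewrite mxE; exact: clip_itv.
have cbox : compact box.
  apply: bounded_closed_compact.
    exists kappa; split; first exact: num_real.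
    move=> y ky p pb; rewrite /Num.norm /= mx_normrE.
    apply: bigmax_le => [|[a i] _ /=]; first by rewrite ltW// (lt_trans k0).
    by rewrite (ord1 a); have /andP[p0 pk] := pb i; rewrite ger0_norm// (le_trans pk)// ltW.
  have -> : box = \bigcap_(i in [set: 'I_N]) ((fun p : 'rV[R]_N => p ord0 i) @^-1` `[0, kappa]%classic).
    apply/seteqP; split => p pb i; first by move=> _ /=; rewrite in_itv; exact: pb.
    by have := pb i Logic.I; rewrite /= in_itv.
  apply: closed_bigI => i _.
  by move/continuous_closedP : (@coord_continuous R 1 N ord0 i); apply; exact: interval_closed.
have cG i : continuous (fun p => G p ord0 i).
  rewrite (_ : (fun _ => _) = clip kappa \o
      fun p : 'rV[R]_N => p ord0 i - rho * (p *m B) ord0 i + rho * b i); last first.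
    by apply/funext => q /=; rewrite !mxE.
  move=> p; apply: continuous_comp; last exact: continuous_clip.
  move: p; apply: continuous_addr; last exact: continuous_cstr.
  apply: continuous_subr; first exact: continuous_coord.
  by apply: continuous_mulr; [exact: continuous_cstr|exact: continuous_mulmx_coord].
have cF : continuous (fun p => dotv (G p - p) (G p - p)).
  have cGp i : continuous (fun p => (G p - p) ord0 i).
    rewrite (_ : (fun _ => _) = fun p => G p ord0 i - p ord0 i); last first.
      by apply/funext => p; rewrite [LHS]mxE [X in _ + X]mxE.
    by apply: continuous_subr; [exact: cG|exact: continuous_coord].
  exact: continuous_dotv.
(* A minimizer of |G p - p| on the box is a fixed point, as G decreases it. *)
have [p /set_mem pbox pmin] :=
  compact_EVT_min (ex_intro _ _ (Gbox 0)) cbox (continuous_subspaceT cF).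
have pG : G p = p.
  apply/eqP; rewrite -subr_eq0; apply/negPn/negP => d0.
  have := pmin (G p) (mem_set (Gbox p)); rewrite leNgt => /negP; apply.
  apply: le_lt_trans (contr _ d0).
  (* [clip] is nonexpansive in each coordinate, and [b] cancels in the difference of its arguments,
     which leaves the linear map of [contr] at G p - p. *)
  apply: ler_sum => i _; rewrite -!expr2.
  rewrite [(G (G p) - G p) ord0 i]mxE [(- G p) ord0 i]mxE !(mxE _ (fun _ i => clip _ _)).
  apply: le_trans (clip_nonexpansive _ _ k0) _.
  rewrite le_eqVlt; apply/orP; left; apply/eqP; congr (_ ^+ 2).
  by rewrite mulmxBl !mxE; lra.
pose r i := b i - \sum_j A i j * p ord0 j.
exists (fun i => p ord0 i + (s i)^-1 * r i) => i.
(* The fixed point for the common step rho is also one for the step (s j)^-1 in coordinate j.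
   Clipping the witness thus returns p, and the equation becomes the definition of [r]. *)
have clipE j : clip kappa (p ord0 j + (s j)^-1 * r j) = p ord0 j.
  apply: (@clip_rescale _ _ _ rho) => //; first by rewrite invr_gt0.
  rewrite -[RHS](congr1 (fun q : 'rV[R]_N => q ord0 j) pG) mxE; congr clip.
  by rewrite 3!mxE BE /r; lra.
under eq_bigr do rewrite clipE.
by rewrite clipE [p ord0 i + _]addrC addrK mulVKf ?gt_eqF ?s0// /r addrC subrK.
Qed.

End truncated_system.

(** * Borel sets and Lebesgue spaces *)

Section row_borel.
Context {R : realType} {n : nat}.
Implicit Types (x y : 'rV[R]_n) (A : set 'rV[R]_n).

Let measurable_ball (a e : R) : measurable (ball a e).
Proof. by rewrite ball_itv; exact: measurable_itv. Qed.

(** The max-norm ball, spelt out by coordinates so that [leb_box] gives its measure. *)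
Definition cube x (e : R) : set 'rV[R]_n :=
  [set y | forall i, `|x ord0 i - y ord0 i| < e].

Lemma nbhs_cubeP x A : nbhs x A <-> exists2 e : R, 0 < e & cube x e `<=` A.
Proof.
split=> [/nbhs_ballP[e /= e0 xeA]|[e e0 xeA]].
  exists e => // y xy; apply: xeA; split => // i j.
  by rewrite (ord1 i); exact: xy.
apply/nbhs_ballP; exists e => //= y [_ xy]; apply: xeA => i; exact: xy.
Qed.

Lemma measurable_cube x e : measurable (cube x e).
Proof.
rewrite (_ : cube x e =
    \bigcap_(i in [set: 'I_n]) ((fun y : 'rV[R]_n => y ord0 i) @^-1` (ball (x ord0 i) e))).
  apply: fin_bigcap_measurable => // i _; rewrite -[X in measurable X]setTI.
  by apply: (@measurable_row_coord _ R n i measurableT); exact: measurable_ball.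
by apply/seteqP; split => y xy i; [move=> _|]; exact: xy.
Qed.

Lemma leb_cube x e : 0 < e -> leb n (cube x e) = (\prod_(i < n) (e *+ 2)%:E)%E.
Proof.
move=> e0; have := leb_box (fun i => measurable_ball (x ord0 i) e).
by under eq_bigr do rewrite lebesgue_measure_ball ?ltW//; move=> <-.
Qed.

Lemma leb_cube_gt0 x e : 0 < e -> (0 < leb n (cube x e))%E.
Proof.
move=> e0; rewrite leb_cube// prodEFin lte_fin prodr_gt0// => i _.
by rewrite mulrn_wgt0.
Qed.

Lemma leb_bounded A : bounded_set A -> measurable A -> (leb n A < +oo)%E.
Proof.
(* [bounded_set] bounds the norm by every number above M, here |M| + 1; one more unit accounts for
   the strict inequality in [cube]. *)
move=> [M [_ bM]] mA; pose e := `|M| + 2.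
have Me : M < `|M| + 1 by rewrite ltr_pwDr// ler_norm.
have /le_lt_trans : (leb n A <= leb n (cube 0 e))%E.
  apply: le_measure; rewrite ?inE//; first exact: measurable_cube.
  move=> y Ay i; rewrite mxE sub0r normrN.
  have := bM _ Me y Ay; rewrite {1}/Num.norm /= mx_normrE => h.
  apply: (@le_lt_trans _ _ (`|M| + 1)); last by rewrite ltrD2l ltr1n.
  by apply: le_trans h; rewrite (le_bigmax _ (fun i => `|y i.1 i.2|) (ord0, i)).
apply; rewrite leb_cube; first by rewrite prodEFin ltry.
by rewrite ltr_wpDl.
Qed.

(** The sigma-algebra on rows is generated by the coordinates, not by the topology. An open set
    belongs to it as the countable union of the cubes with rational centre and radius 1/(k+1) that
    it contains. *)
Lemma open_measurable_row A : open A -> measurable A.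
Proof.
move=> oA.
pose c (q : 'rV[rat]_n) : 'rV[R]_n := map_mx ratr q.
pose F (p : 'rV[rat]_n * nat) : set 'rV[R]_n :=
  [set y | cube (c p.1) p.2.+1%:R^-1 `<=` A /\ cube (c p.1) p.2.+1%:R^-1 y].
have -> : A = \bigcup_p F p.
  apply/seteqP; split => [y Ay|y [p _ [pA py]]]; last exact: pA.
  have /nbhs_cubeP[e e0 yeA] : nbhs y A by exact: open_nbhs_nbhs.
  have [k ke] : exists k : nat, k.+1%:R^-1 < e / 2.
    by have [k _ kP] := near_infty_natSinv_lt (PosNum (divr_gt0 e0 (ltr0Sn R 1)));
      exists k; exact: (kP k (leqnn k)).
  have k0 : (0 : R) < k.+1%:R^-1 by rewrite invr_gt0.
  have dens i : exists q : rat, `|ratr q - y ord0 i| < k.+1%:R^-1.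
    have /rat_in_itvoo[q] : y ord0 i < y ord0 i + k.+1%:R^-1 by rewrite ltrDl.
    rewrite in_itv /= => /andP[q1 q2]; exists q.
    by rewrite gtr0_norm ?subr_gt0// ltrBlDl.
  have [q qP] := choice dens.
  have qy : cube (c (\row_i q i)) k.+1%:R^-1 y by move=> i; rewrite !mxE.
  exists (\row_i q i, k) => //; split => //= z qz; apply: yeA => i.
  have := qz i; have := qy i; rewrite distrC => h1 h2.
  by apply: le_lt_trans (ler_distD (c (\row_i q i) ord0 i) _ _) _; rewrite (splitr e) ltrD// (lt_trans _ ke).
apply: countable_bigcupT_measurable => // -[q k].
have [qA|nqA] := pselect (cube (c q) k.+1%:R^-1 `<=` A).
  by rewrite (_ : F _ = cube (c q) k.+1%:R^-1); [exact: measurable_cube|apply/seteqP; split => [y []|y yq]].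
by rewrite (_ : F _ = set0)//; apply/seteqP; split => [y []|y].
Qed.

Lemma closed_measurable_row A : closed A -> measurable A.
Proof. by move/closed_openC/open_measurable_row/measurableC; rewrite setCK. Qed.

Lemma continuous_measurable_row (f : 'rV[R]_n -> R) :
  continuous f -> measurable_fun setT f.
Proof.
move=> /continuousP cf; apply: (measurability _ (RGenOpens.measurableE R)).
move=> _ [_ [a [b ->] <-]]; rewrite setTI; apply: open_measurable_row.
exact/cf/interval_open.
Qed.

End row_borel.

Section lebesgue_spaces.
Context {R : realType} {d : nat} (G : set 'rV[R]_d) (mG : measurable G).
Implicit Types (p : \bar R) (b v w : 'rV[R]_d -> R).
Local Notation mu := (@leb R d).

Lemma eq_restrict v w : (forall x, G x -> v x = w x) -> v \_ G = w \_ G.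
Proof.
move=> vw; apply/funext => x; rewrite !patchE; case: ifPn => // /set_mem; exact: vw.
Qed.

Lemma eq_inL p v w : (forall x, G x -> v x = w x) -> inL G p v -> inL G p w.
Proof. by move=> vw; rewrite /inL (eq_restrict vw). Qed.

Lemma eq_normL p v w : (forall x, G x -> v x = w x) -> normL G p v = normL G p w.
Proof. by move=> vw; rewrite /normL (eq_restrict vw). Qed.

Lemma inL_measurableT p v : inL G p v -> measurable_fun setT (v \_ G).
Proof. by rewrite /inL inE => /andP[/[!inE]]. Qed.

Lemma inL_measurable p v : inL G p v -> measurable_fun G v.
Proof.
by rewrite /inL inE => /andP[/[!inE] /= mv _]; apply/measurable_restrictT.
Qed.

Lemma inL2_lin (c : R) v w : inL G 2%:E v -> inL G 2%:E w ->
  inL G 2%:E (fun x => c * v x + w x).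
Proof.
rewrite /inL => vL wL.
rewrite (_ : _ \_ G = c *: (v \_ G) + w \_ G); last first.
  apply/funext => x; rewrite !fctE !patchE; case: ifPn => //= _.
  by rewrite /point /= scaler0 addr0.
exact: (Lfun_submod_closed mu (lee1n 2)).2.
Qed.

Lemma inL2_0 : inL G 2%:E (fun=> 0 : R).
Proof.
rewrite /inL (_ : _ \_ G = 0); first exact: (Lfun_submod_closed mu (lee1n 2)).1.
by apply/funext => x; rewrite patchE; case: ifPn.
Qed.

Lemma inL2_sub v w : inL G 2%:E v -> inL G 2%:E w ->
  inL G 2%:E (fun x => v x - w x).
Proof.
move=> vL wL; apply: eq_inL (inL2_lin (-1) wL vL) => x _.
by rewrite mulN1r addrC.
Qed.

Lemma normL_ge0 p v : 0 <= normL G p v.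
Proof. by rewrite fine_ge0// Lnorm_ge0. Qed.

Lemma inL2_fin v : inL G 2%:E v ->
  ('N[mu]_2%:E[EFin \o (v \_ G)])%E \is a fin_num.
Proof.
rewrite /inL inE => /andP[_ /[!inE] /=]; rewrite /finite_norm ge0_fin_numE//.
exact: Lnorm_ge0.
Qed.

Lemma integrable_mul v w : inL G 2%:E v -> inL G 2%:E w ->
  mu.-integrable G (EFin \o (fun x => v x * w x)).
Proof.
move=> vL wL; apply/integrable_mkcond => //.
have /Lfun1_integrable := Lfun2_mul_Lfun1 vL wL.
apply: eq_integrable => // x _ /=; rewrite !patchE.
by case: ifPn => //= _; rewrite /point /= mul0r.
Qed.

Lemma normL2_sqr v : inL G 2%:E v -> normL G 2%:E v ^+ 2 = ip G v v.
Proof.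
move=> vL; rewrite /ip /Rintegral integral_mkcond.
rewrite -[RHS](_ : fine (\int[mu]_x `|(EFin \o (v \_ G)) x| `^ 2) = _)%E.
  rewrite -(powR_Lnorm mu (EFin \o (v \_ G))) ?pnatr_eq0//.
  by rewrite -(fineK (inL2_fin vL)) /= powR_mulrn// fine_ge0// Lnorm_ge0.
congr fine; apply: eq_integral => x _ /=; rewrite !patchE; case: ifPn => _ /=.
  by rewrite powR_mulrn// real_normK ?num_real// expr2.
by rewrite /point /= normr0 powR0.
Qed.

Lemma holder_L2 v w : inL G 2%:E v -> inL G 2%:E w ->
  \int[mu]_(x in G) `|v x * w x| <= normL G 2%:E v * normL G 2%:E w.
Proof.
move=> vL wL.
have := @hoelder _ _ _ mu _ _ 2 2 (inL_measurableT vL) (inL_measurableT wL) (ltr0Sn _ _) (ltr0Sn _ _).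
rewrite [RHS]splitr !div1r => /(_ erefl).
rewrite Lnorm1 -(fineK (inL2_fin vL)) -(fineK (inL2_fin wL)) -EFinM => h.
rewrite /Rintegral (_ : integral _ _ _ =
    \int[mu]_x `|(EFin \o ((v \_ G) \* (w \_ G))%R) x|)%E.
  by rewrite -lee_fin fineK// ge0_fin_numE ?integral_ge0// (le_lt_trans h)// ltry.
rewrite integral_mkcond; apply: eq_integral => x _ /=.
by rewrite !patchE; case: ifPn => //= _; rewrite /point /= mul0r normr0.
Qed.

Lemma inLoo_bounded b : inL G +oo%E b ->
  exists2 C : R, 0 <= C & \forall x \ae mu, G x -> `|b x| <= C.
Proof.
rewrite /inL inE => /andP[_ /[!inE] /=]; rewrite /finite_norm unlock.
(* The norm of exponent +oo is the essential supremum only on a space of positive measure, hence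
   this preliminary check. *)
have -> : (0 < mu setT)%E.
  apply: lt_le_trans (leb_cube_gt0 0 ltr01) _.
  by apply: le_measure; rewrite ?inE//; exact: measurable_cube.
set s := ess_sup _ _ => soo; exists `|fine s| => //.
have : (s <= `|fine s|%:E)%E.
  by move: soo; case: s => [r _|//|_] /=; rewrite ?lee_fin ?ler_norm ?leNye.
move=> /ess_supP; apply: filterS => x /=; rewrite patchE => h Gx.
by move: h; rewrite mem_set// lee_fin.
Qed.

Lemma inLoo_mul b : inL G +oo%E b ->
  exists2 C : R, 0 <= C & forall h : 'rV[R]_d -> R, mu.-integrable G (EFin \o h) ->
    mu.-integrable G (EFin \o (fun x => b x * h x)) /\
    `|\int[mu]_(x in G) (b x * h x)| <= C * \int[mu]_(x in G) `|h x|.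
Proof.
move=> bL; have [C C0 bC] := inLoo_bounded bL; exists C => // h hi.
have mb := inL_measurable bL; have mh : measurable_fun G h by apply/measurable_EFinP; exact: measurable_int hi.
have hn : mu.-integrable G (EFin \o (fun x => C * `|h x|)).
  by apply: (integrableZl mG C (integrable_norm hi)).
have le : (\int[mu]_(x in G) `|(b x * h x)%:E| <= \int[mu]_(x in G) (C * `|h x|)%:E)%E.
  apply: ae_ge0_le_integral => //.
  - by do 2 apply: measurableT_comp => //; exact: measurable_funM.
  - by move=> x _; rewrite lee_fin mulr_ge0.
  - exact: measurable_int hn.
  - apply: filterS bC => x /= bx Gx; rewrite lee_fin normrM ler_wpM2r//; exact: bx.
have bhi : mu.-integrable G (EFin \o (fun x => b x * h x)).
  apply/integrableP; split; first by apply/measurable_EFinP; exact: measurable_funM.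
  apply: le_lt_trans le _; move/integrableP: hn => [_]; congr (_ < _)%E.
  by apply: eq_integral => x _ /=; rewrite ger0_norm// mulr_ge0.
split=> //; apply: le_trans (le_normr_Rintegral mG bhi) _.
rewrite -RintegralZl//; last exact: integrable_norm.
apply: fine_le => //.
- exact: (integrable_fin_num mG (integrable_norm bhi)).
- exact: (integrable_fin_num mG hn).
Qed.

(** Continuity on L^2 x L^2 serves twice: arguments of zero L^2 norm contribute nothing, which makes
    the choice of a gradient harmless, and the integrals pass to the limit along sequences of test
    functions. *)
Lemma trilinear_bound b : inL G +oo%E b ->
  exists2 C : R, 0 <= C & forall v w, inL G 2%:E v -> inL G 2%:E w ->
    mu.-integrable G (EFin \o (fun x => b x * (v x * w x))) /\
    `|\int[mu]_(x in G) (b x * (v x * w x))| <= C * (normL G 2%:E v * normL G 2%:E w).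
Proof.
move=> /inLoo_mul[C C0 bC]; exists C => // v w vL wL.
have [bi ble] := bC _ (integrable_mul vL wL); split=> //.
by apply: le_trans ble _; rewrite ler_wpM2l// holder_L2.
Qed.

Lemma eq_Rintegral_on v w : (forall x, G x -> v x = w x) ->
  \int[mu]_(x in G) v x = \int[mu]_(x in G) w x.
Proof. by move=> vw; apply: eq_Rintegral => x /set_mem; exact: vw. Qed.

Lemma Rintegral_lin (c : R) v w :
  mu.-integrable G (EFin \o v) -> mu.-integrable G (EFin \o w) ->
  \int[mu]_(x in G) (c * v x + w x) =
    c * \int[mu]_(x in G) v x + \int[mu]_(x in G) w x.
Proof.
by move=> vi wi; rewrite RintegralD// ?RintegralZl//; exact: (integrableZl mG c vi).
Qed.

End lebesgue_spaces.

(** * Test functions and H^1_0 *)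

Section test_functions.
Context {R : realType} {d : nat}.
Implicit Types (u v w : 'rV[R]_d -> R) (Omega : set 'rV[R]_d).

Definition smooth1 v : Prop := continuous v /\ forall i x, derivable v x (delta_mx ord0 i).

(** Coinduction for [smooth]: the iterated partial derivatives of a member of P never leave P. *)
Lemma smooth_coind (P : ('rV[R]_d -> R) -> Prop) :
  (forall u, P u -> smooth1 u /\ forall i, P (partial i u)) ->
  forall u, P u -> smooth u.
Proof.
move=> Pstep u Pu s /=; apply: (proj1 (Pstep _ _)).
by elim: s => [|i s IH] //=; exact: (Pstep _ IH).2.
Qed.

Lemma smooth_smooth1 v : smooth v -> smooth1 v.
Proof. by move=> /(_ [::]). Qed.

Lemma smooth_partial i v : smooth v -> smooth (partial i v).
Proof. by move=> sv s; have := sv (rcons s i); rewrite foldr_rcons. Qed.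

Lemma partialD i u v : smooth1 u -> smooth1 v ->
  partial i (fun x => u x + v x) = fun x => partial i u x + partial i v x.
Proof. by move=> [_ du] [_ dv]; apply/funext => x; rewrite /partial deriveD. Qed.

Lemma partialM i u v : smooth1 u -> smooth1 v ->
  partial i (fun x => u x * v x) = fun x => partial i u x * v x + u x * partial i v x.
Proof.
move=> [_ du] [_ dv]; apply/funext => x; rewrite /partial (deriveM (du i x) (dv i x)).
by rewrite addrC /GRing.scale /= mulrC.
Qed.

Lemma partialZ i (c : R) v : smooth1 v ->
  partial i (fun x => c * v x) = fun x => c * partial i v x.
Proof. by move=> [_ dv]; apply/funext => x; rewrite /partial deriveZ. Qed.

Lemma smooth1D u v : smooth1 u -> smooth1 v -> smooth1 (fun x => u x + v x).
Proof.
move=> [cu du] [cv dv]; split; first exact: continuous_addr.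
by move=> i x; exact: derivableD.
Qed.

Lemma smooth1M u v : smooth1 u -> smooth1 v -> smooth1 (fun x => u x * v x).
Proof.
move=> [cu du] [cv dv]; split; first exact: continuous_mulr.
by move=> i x; exact: derivableM.
Qed.

Lemma smooth1_cst (c : R) : smooth1 (fun=> c : R).
Proof. by split=> [|i x]; [exact: continuous_cstr|exact: derivable_cst]. Qed.

Lemma partial_cst (i : 'I_d) (c : R) : partial i (fun=> c) = (fun=> 0).
Proof. by apply/funext => x; rewrite /partial derive_cst. Qed.

Lemma partial_lin i (c : R) u v : smooth1 u -> smooth1 v ->
  partial i (fun x => c * u x + v x) = fun x => c * partial i u x + partial i v x.
Proof.
by move=> su sv; rewrite (partialD i (smooth1M (smooth1_cst c) su) sv) (partialZ i c su).
Qed.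

(** Sums of products of smooth functions. A single product is not stable under differentiation, but
    by the Leibniz rule these sums are, so they form an invariant for [smooth_coind]. *)
Inductive smooth_span : ('rV[R]_d -> R) -> Prop :=
| smooth_span0 : smooth_span (fun=> 0)
| smooth_spanM u v w : smooth u -> smooth v -> smooth_span w ->
    smooth_span (fun x => u x * v x + w x).

Lemma smooth_span_smooth u : smooth_span u -> smooth u.
Proof.
apply: smooth_coind => {}u; elim=> [|{}u v w su sv ssw [w1 wi]].
  split=> [|i]; first exact: smooth1_cst.
  by rewrite partial_cst; exact: smooth_span0.
have [su1 sv1] := (smooth_smooth1 su, smooth_smooth1 sv).
have uv1 := smooth1M su1 sv1.
split=> [|i]; first exact: smooth1D.
rewrite partialD// partialM//.
rewrite (_ : (fun _ => _) = fun x => partial i u x * v x + (u x * partial i v x + partial i w x)); last first.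
  by apply/funext => x; rewrite addrA.
apply: (smooth_spanM (smooth_partial i su) sv).
exact: (smooth_spanM su (smooth_partial i sv) (wi i)).
Qed.

Lemma smooth_cst (c : R) : @smooth R d (fun=> c).
Proof.
apply: (@smooth_coind (fun u => exists c, u = fun=> c)); last by exists c.
move=> _ [{}c ->]; split=> [|i]; first exact: smooth1_cst.
by rewrite partial_cst; exists 0.
Qed.

Lemma smoothM u v : smooth u -> smooth v -> smooth (fun x => u x * v x).
Proof.
move=> su sv; rewrite (_ : (fun _ => _) = fun x => u x * v x + 0).
  by apply: smooth_span_smooth; apply: smooth_spanM => //; exact: smooth_span0.
by apply/funext => x; rewrite addr0.
Qed.

Lemma smooth_lin (c : R) u v : smooth u -> smooth v -> smooth (fun x => c * u x + v x).
Proof.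
move=> su sv; rewrite (_ : (fun _ => _) = fun x => c * u x + (1 * v x + 0)).
  apply: smooth_span_smooth; apply: (smooth_spanM (smooth_cst c) su).
  exact: (smooth_spanM (smooth_cst 1) sv smooth_span0).
by apply/funext => x; rewrite addr0 mul1r.
Qed.

(** Off the closed support, v vanishes in a whole neighbourhood of the point, so its derivative
    there is that of a constant. *)
Lemma closure_support_partial i v :
  [set x | partial i v x != 0] `<=` closure [set x | v x != 0].
Proof.
move=> x /= pv0; apply: contrapT => nvx; move/eqP : pv0; apply.
have : \forall y \near x, v y = 0.
  have : nbhs x (~` closure [set x | v x != 0]).
    by apply: open_nbhs_nbhs; split => //; apply: closed_openC; exact: closed_closure.
  apply: filterS => y /= ny; apply/eqP; apply: contra_notT ny => vy0.
  exact: subset_closure.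
by move=> v0; rewrite /partial (near_eq_derive (g := fun=> 0)) ?derive_cst.
Qed.

Lemma test_fun_sub Omega u v w : smooth u -> test_fun Omega v -> test_fun Omega w ->
  [set x | u x != 0] `<=` closure [set x | v x != 0] `|` closure [set x | w x != 0] ->
  test_fun Omega u.
Proof.
move=> su [_ cv vO] [_ cw wO] uvw.
have uvw' : closure [set x | u x != 0] `<=`
    closure [set x | v x != 0] `|` closure [set x | w x != 0].
  have cl : closed (closure [set x | v x != 0] `|` closure [set x | w x != 0]).
    by apply: closedU; exact: closed_closure.
  by rewrite [X in _ `<=` X]((closure_id _).1 cl); exact: closureS.
split=> //; last by move=> x /uvw'[/vO|/wO].
apply: subclosed_compact uvw'; first exact: closed_closure.
exact: compactU.
Qed.

Lemma test_fun_lin Omega (c : R) v w : test_fun Omega v -> test_fun Omega w ->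
  test_fun Omega (fun x => c * v x + w x).
Proof.
move=> tv tw; apply: (test_fun_sub _ tv tw).
  by apply: smooth_lin; [case: tv|case: tw].
move=> x /=; have [-> |v0 _] := eqVneq (v x) 0; last by left; exact: subset_closure.
by rewrite mulr0 add0r => w0; right; exact: subset_closure.
Qed.

Lemma test_funM Omega v w : test_fun Omega v -> test_fun Omega w ->
  test_fun Omega (fun x => v x * w x).
Proof.
move=> tv tw; apply: (test_fun_sub _ tv tw).
  by apply: smoothM; [case: tv|case: tw].
by move=> x /=; rewrite mulf_eq0 negb_or => /andP[v0 _]; left; exact: subset_closure.
Qed.

Lemma test_fun_partial Omega i v : test_fun Omega v -> test_fun Omega (partial i v).
Proof.
move=> tv; apply: (test_fun_sub _ tv tv); first by apply: smooth_partial; case: tv.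
by move=> x /closure_support_partial; left.
Qed.

Lemma test_fun_bounded Omega v : test_fun Omega v -> exists C : R, forall x, `|v x| <= C.
Proof.
move=> [/smooth_smooth1[cv _] + _]; set K := closure _ => cK.
have [[x0 Kx0]|K0] := pselect (K !=set0); last first.
  exists 0 => x; have [->|vx] := eqVneq (v x) 0; first by rewrite normr0.
  by case: K0; exists x; exact: subset_closure.
have cn : continuous (fun x => `|v x|).
  by move=> x; exact: (continuous_comp (cv x) (@norm_continuous _ R^o (v x))).
have [m _ mP] := compact_EVT_max (ex_intro _ _ Kx0) cK (continuous_subspaceT cn).
exists `|v m| => x; have [->|vx] := eqVneq (v x) 0; first by rewrite normr0.
by apply: mP; apply/mem_set; exact: subset_closure.
Qed.

End test_functions.

(** * Gradients in H^1_0, their uniqueness in L^2, and weighted L^2 products *)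

Section sobolev_theory.
Context {R : realType} {d : nat} (Omega : set 'rV[R]_d).
Hypotheses (mO : measurable Omega) (finO : (leb d Omega < +oo)%E).
Implicit Types (b v w z : 'rV[R]_d -> R) (g h : 'rV[R]_d -> 'rV[R]_d).
Local Notation mu := (@leb R d).
Local Notation L2 := (inL Omega 2%:E).
Local Notation nrm := (normL Omega 2%:E).

Lemma bounded_inL2 v (C : R) : measurable_fun Omega v ->
  (forall x, Omega x -> `|v x| <= C) -> L2 v.
Proof.
move=> mv vC; rewrite /inL inE; apply/andP; split; rewrite inE /=.
  exact/(measurable_restrictT v mO).
rewrite /finite_norm unlock poweR_lty//.
rewrite (_ : integral _ _ _ = \int[mu]_(x in Omega) (v x ^+ 2)%:E)%E; last first.
  rewrite [RHS]integral_mkcond; apply: eq_integral => x _ /=; rewrite !patchE; case: ifPn => _ /=.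
    by rewrite powR_mulrn// real_normK ?num_real.
  by rewrite /point /= normr0 powR0.
apply: (@le_lt_trans _ _ (\int[mu]_(x in Omega) (C ^+ 2)%:E)%E).
  apply: ge0_le_integral => //.
  - by move=> x _; rewrite lee_fin sqr_ge0.
  - by apply/measurable_EFinP; exact: measurable_funX.
  - move=> x Ox; rewrite lee_fin -real_normK ?num_real//.
    by rewrite ler_pXn2r ?nnegrE ?vC// (le_trans _ (vC x Ox)).
by rewrite integral_cst// lte_mul_pinfty// lee_fin sqr_ge0.
Qed.

Lemma test_fun_inL2 v : test_fun Omega v -> L2 v.
Proof.
move=> tv; have [C vC] := test_fun_bounded tv.
apply: (@bounded_inL2 _ C) => //; apply: measurable_funTS.
by apply: continuous_measurable_row; case: tv => /smooth_smooth1[].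
Qed.

Lemma ip_lin (c : R) v w z : L2 v -> L2 w -> L2 z ->
  ip Omega (fun x => c * v x + w x) z = c * ip Omega v z + ip Omega w z.
Proof.
move=> vL wL zL; rewrite -Rintegral_lin//; try exact: integrable_mul.
by apply: eq_Rintegral_on => x _; rewrite mulrDl mulrA.
Qed.

Lemma ipC v w : ip Omega v w = ip Omega w v.
Proof. by apply: eq_Rintegral_on => x _; rewrite mulrC. Qed.

Lemma ip_le v w : L2 v -> L2 w -> `|ip Omega v w| <= nrm v * nrm w.
Proof.
move=> vL wL; apply: le_trans _ (holder_L2 vL wL).
by apply: le_normr_Rintegral => //; exact: integrable_mul.
Qed.

(** Minkowski's inequality, obtained from Cauchy-Schwarz by expanding the square. *)
Lemma normL_lin (c : R) v w : L2 v -> L2 w ->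
  nrm (fun x => c * v x + w x) <= `|c| * nrm v + nrm w.
Proof.
move=> vL wL; have lL := inL2_lin c vL wL.
rewrite -(@ler_pXn2r _ 2) ?nnegrE ?addr_ge0 ?mulr_ge0 ?normL_ge0//.
rewrite normL2_sqr// ip_lin//.
rewrite (ipC v (fun x => c * v x + w x)) (ipC w (fun x => c * v x + w x)) !ip_lin//.
rewrite sqrrD exprMn real_normK ?num_real//.
rewrite !normL2_sqr// (ipC w v).
have := ip_le vL wL; set a := ip _ v w; set t := nrm v * nrm w => h.
have : c * a <= `|c| * t by rewrite (le_trans (ler_norm _))// normrM ler_wpM2l.
rewrite (_ : (`|c| * nrm v * nrm w) *+ 2 = (`|c| * t) *+ 2); last by rewrite -mulrA.
by rewrite mulrDr !mulr2n mulrA -expr2; lra.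
Qed.

Lemma cvg0_le_bound (x C : R) (a : nat -> R) :
  a n @[n --> \oo] --> (0 : R) -> (forall n, x <= C * a n) -> x <= 0.
Proof.
move=> a0 xa; have Ca : C * a n @[n --> \oo] --> C * 0 by apply: cvgM => //; exact: cvg_cst.
rewrite mulr0 in Ca; apply: (@cvgr_to_ge _ \oo _ _ _ _ _ Ca).
by apply: nearW.
Qed.

Lemma cvg0_squeeze (a b : nat -> R) : (forall n, 0 <= a n <= b n) ->
  b n @[n --> \oo] --> (0 : R) -> a n @[n --> \oo] --> (0 : R).
Proof.
move=> ab b0; apply: (squeeze_cvgr _ (cvg_cst 0) b0).
by apply: nearW => n; exact: ab.
Qed.

(** Integrals and norms see a function only through Omega, so agreement there suffices; the
    approximating sequence is the same combination of the two given ones. *)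
Lemma H10_grad_lin (c : R) v g w h z :
  is_H10_grad Omega v g -> is_H10_grad Omega w h ->
  (forall x, Omega x -> z x = c * v x + w x) ->
  is_H10_grad Omega z (fun x => c *: g x + h x).
Proof.
move=> [[vL gL vW] [p [pt pv pg]]] [[wL hL wW] [q [qt qw qh]]] zE.
have ptL n := test_fun_inL2 (pt n); have qtL n := test_fun_inL2 (qt n).
have pdL n i := test_fun_inL2 (test_fun_partial i (pt n)).
have qdL n i := test_fun_inL2 (test_fun_partial i (qt n)).
have zE' x : Omega x -> c * v x + w x = z x by move=> /zE.
have ghE i x : Omega x -> c * g x ord0 i + h x ord0 i = (c *: g x + h x) ord0 i.
  by rewrite !mxE.
split.
  split; first exact: eq_inL zE' (inL2_lin c vL wL).
    by move=> i; apply: eq_inL (ghE i) (inL2_lin c (gL i) (hL i)).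
  move=> psi psit i; have psiL := test_fun_inL2 psit.
  have dpsiL := test_fun_inL2 (test_fun_partial i psit).
  rewrite (_ : ip _ z _ = ip Omega (fun x => c * v x + w x) (partial i psi)); last first.
    by apply: eq_Rintegral_on => x Ox; rewrite zE.
  rewrite (_ : ip _ _ psi = ip Omega (fun x => c * g x ord0 i + h x ord0 i) psi); last first.
    by apply: eq_Rintegral_on => x Ox; rewrite ghE.
  by rewrite !ip_lin// vW// wW// opprD mulrN.
exists (fun n x => c * p n x + q n x); split.
- by move=> n; exact: test_fun_lin.
- have : `|c| * nrm (fun x => p n x - v x) + nrm (fun x => q n x - w x) @[n --> \oo] --> `|c| * 0 + 0.
    by apply: cvgD => //; apply: cvgM => //; exact: cvg_cst.
  rewrite mulr0 addr0; apply: cvg0_squeeze => n; rewrite normL_ge0 /=.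
  rewrite (@eq_normL _ _ _ _ _ (fun x => c * (p n x - v x) + (q n x - w x))).
    by apply: normL_lin; exact: inL2_sub.
  by move=> x Ox; rewrite zE//; ring.
move=> i.
have : `|c| * nrm (fun x => partial i (p n) x - g x ord0 i) +
    nrm (fun x => partial i (q n) x - h x ord0 i) @[n --> \oo] --> `|c| * 0 + 0.
  by apply: cvgD => //; apply: cvgM => //; exact: cvg_cst.
rewrite mulr0 addr0; apply: cvg0_squeeze => n; rewrite normL_ge0 /=.
rewrite (@eq_normL _ _ _ _ _ (fun x => c * (partial i (p n) x - g x ord0 i) +
                                (partial i (q n) x - h x ord0 i))).
  by apply: normL_lin; exact: inL2_sub.
have [sp sq] : smooth1 (p n) /\ smooth1 (q n).
  by split; apply: smooth_smooth1; [case: (pt n)|case: (qt n)].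
by move=> x Ox; rewrite (partial_lin i c sp sq) -ghE//; ring.
Qed.

(* Since v vanishes, g is L^2-orthogonal to all test functions, among them the
   derivatives of the approximating sequence, which converge to g. *)
Lemma H10_grad_null v g : is_H10_grad Omega v g -> (forall x, Omega x -> v x = 0) ->
  forall i, nrm (fun x => g x ord0 i) = 0.
Proof.
move=> [[vL gL vW] [p [pt pv pg]]] v0 i.
have g_orth psi : test_fun Omega psi -> ip Omega (fun x => g x ord0 i) psi = 0.
  move=> /vW /(_ i) /eqP; rewrite (_ : ip _ v _ = 0).
    by rewrite eq_sym oppr_eq0 => /eqP.
  rewrite (_ : ip _ _ _ = \int[mu]_(x in Omega) (0 : R)); first by rewrite Rintegral_cst// mul0r.
  by apply: eq_Rintegral_on => x Ox; rewrite v0// mul0r.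
have gg : ip Omega (fun x => g x ord0 i) (fun x => g x ord0 i) <= 0.
  apply: (cvg0_le_bound (pg i) (C := nrm (fun x => g x ord0 i))) => n.
  have tpL := test_fun_inL2 (test_fun_partial i (pt n)).
  have dL := inL2_sub tpL (gL i).
  have := ip_le dL (gL i); rewrite mulrC; apply: le_trans.
  rewrite -normrN; apply: le_trans _ (ler_norm _).
  rewrite (_ : ip _ (fun x => _ - _) _ =
      ip Omega (fun x => -1 * g x ord0 i + partial i (p n) x) (fun x => g x ord0 i)); last first.
    by apply: eq_Rintegral_on => x _; congr (_ * _); ring.
  have p0 : ip Omega (partial i (p n)) (fun x => g x ord0 i) = 0.
    by rewrite ipC; exact: g_orth (test_fun_partial i (pt n)).
  by rewrite (ip_lin (-1) (gL i) tpL (gL i)) p0 addr0 mulN1r opprK.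
apply/eqP; rewrite -sqrf_eq0 normL2_sqr//; apply/eqP/le_anti.
by rewrite gg -normL2_sqr// sqr_ge0.
Qed.

(** The common shape of the diffusion and convection terms: an L^oo coefficient against two L^2
    arguments. *)
Definition trilinear b v w : R := \int[mu]_(x in Omega) (b x * (v x * w x)).

Lemma trilinearC b v w : trilinear b v w = trilinear b w v.
Proof. by apply: eq_Rintegral_on => x _; rewrite (mulrC (v x)). Qed.

Section trilinear.
Variable (b : 'rV[R]_d -> R).
Hypothesis bL : inL Omega +oo%E b.

Lemma trilinear_integrable v w : L2 v -> L2 w ->
  mu.-integrable Omega (EFin \o (fun x => b x * (v x * w x))).
Proof. by move=> vL wL; have [C _ /(_ _ _ vL wL)[]] := trilinear_bound mO bL. Qed.

Lemma trilinear_lin (c : R) v w z : L2 v -> L2 w -> L2 z ->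
  trilinear b (fun x => c * v x + w x) z = c * trilinear b v z + trilinear b w z.
Proof.
move=> vL wL zL; rewrite -Rintegral_lin//; try exact: trilinear_integrable.
by apply: eq_Rintegral_on => x _; ring.
Qed.

Lemma trilinear_null v w : L2 v -> L2 w -> nrm v = 0 -> trilinear b v w = 0.
Proof.
move=> vL wL v0; have [C _ /(_ _ _ vL wL)[_]] := trilinear_bound mO bL.
by rewrite v0 mul0r mulr0 normr_le0 => /eqP.
Qed.

Lemma trilinear_sub v w z : L2 v -> L2 w -> L2 z ->
  trilinear b (fun x => v x - w x) z = trilinear b v z - trilinear b w z.
Proof.
move=> vL wL zL; have := trilinear_lin (-1) wL vL zL.
rewrite mulN1r addrC => <-; apply: eq_Rintegral_on => x _; ring.
Qed.

Lemma trilinear_subr v w z : L2 v -> L2 w -> L2 z ->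
  trilinear b z (fun x => v x - w x) = trilinear b z v - trilinear b z w.
Proof. by move=> vL wL zL; rewrite trilinearC trilinear_sub// (trilinearC b v) (trilinearC b w). Qed.

(** Linearity in the form that fits [grad], for which the combination rule holds only up to a
    function of zero L^2 norm. *)
Lemma trilinear_lin_null (c : R) z v w u : L2 z -> L2 v -> L2 w -> L2 u ->
  nrm (fun x => z x - (c * v x + w x)) = 0 ->
  trilinear b z u = c * trilinear b v u + trilinear b w u.
Proof.
move=> zL vL wL uL zvw; have lL := inL2_lin c vL wL.
rewrite -trilinear_lin//; apply/eqP; rewrite -subr_eq0 -trilinear_sub//.
by rewrite trilinear_null//; exact: inL2_sub.
Qed.

Lemma trilinear_cvg (p q : nat -> 'rV[R]_d -> R) v w :
  (forall n, L2 (p n)) -> (forall n, L2 (q n)) -> L2 v -> L2 w ->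
  nrm (fun x => p n x - v x) @[n --> \oo] --> (0 : R) ->
  nrm (fun x => q n x - w x) @[n --> \oo] --> (0 : R) ->
  trilinear b (p n) (q n) @[n --> \oo] --> trilinear b v w.
Proof.
move=> pL qL vL wL pv qw; have [C C0 bC] := trilinear_bound mO bL.
pose e n := nrm (fun x => p n x - v x); pose f n := nrm (fun x => q n x - w x).
have lim0 : C * (e n * f n) + C * (e n * nrm w) + C * (nrm v * f n) @[n --> \oo] --> (0 : R).
  rewrite [X in _ --> X](_ : 0 = C * (0 * 0) + C * (0 * nrm w) + C * (nrm v * 0)); last by ring.
  by apply: cvgD; [apply: cvgD|]; (apply: cvgM; first exact: cvg_cst);
    apply: cvgM => //; exact: cvg_cst.
apply/subr_cvg0; apply/norm_cvg0P.
apply: cvg0_squeeze lim0 => n; rewrite normr_ge0 /=.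
have pvL := inL2_sub (pL n) vL; have qwL := inL2_sub (qL n) wL.
(* The expansion pq - vw = (p - v)(q - w) + (p - v) w + v (q - w), each term of which contains a
   factor tending to 0. *)
rewrite (_ : trilinear b (p n) (q n) - _ = trilinear b (fun x => p n x - v x) (fun x => q n x - w x) +
   trilinear b (fun x => p n x - v x) w + trilinear b v (fun x => q n x - w x)); last first.
  by rewrite !trilinear_sub// !trilinear_subr//; ring.
apply: le_trans (ler_normD _ _) _; apply: lerD; last by case: (bC _ _ vL qwL).
apply: le_trans (ler_normD _ _) _; apply: lerD; first by case: (bC _ _ pvL qwL).
by case: (bC _ _ pvL wL).
Qed.

End trilinear.

(** Integrability of the sum is returned along with its value so that the lemma can be applied to
    its own output, as double sums require. *)
Lemma Rintegral_sumr n (f : 'I_n -> 'rV[R]_d -> R) :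
  (forall i, mu.-integrable Omega (EFin \o f i)) ->
  \int[mu]_(x in Omega) (\sum_i f i x) = \sum_i \int[mu]_(x in Omega) f i x /\
  mu.-integrable Omega (EFin \o (fun x => \sum_i f i x)).
Proof.
elim: n f => [|n IHn] f fi.
  split; first by rewrite big_ord0 -[RHS](mul0r (fine (mu Omega))) -Rintegral_cst//;
    apply: eq_Rintegral_on => x _; rewrite big_ord0.
  apply: (eq_integrable mO (fun=> 0%E)); last exact: integrable0.
  by move=> x _ /=; rewrite big_ord0.
have [IH1 IH2] := IHn (fun i => f (lift ord0 i)) (fun i => fi _).
split.
  rewrite big_ord_recl -IH1 -RintegralD//.
  by apply: eq_Rintegral_on => x _; rewrite big_ord_recl.
rewrite (_ : _ \o _ = (EFin \o f ord0) \+
    (EFin \o (fun x => \sum_i f (lift ord0 i) x)%R))%E; first exact: integrableD.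
by apply/funext => x /=; rewrite big_ord_recl EFinD.
Qed.

(* Test div beta = 0 against psi^2 and pass to the limit. *)
Lemma convection_skew (beta : 'rV[R]_d -> 'rV[R]_d) v g :
  (forall i, inL Omega +oo%E (fun x => beta x ord0 i)) -> div_free Omega beta ->
  is_H10_grad Omega v g ->
  \sum_i trilinear (fun x => beta x ord0 i) (fun x => g x ord0 i) v = 0.
Proof.
move=> bL bdiv [[vL gL _] [p [pt pv pg]]].
have ptL n := test_fun_inL2 (pt n).
have pdL n i := test_fun_inL2 (test_fun_partial i (pt n)).
have zero n : \sum_i trilinear (fun x => beta x ord0 i) (partial i (p n)) (p n) = 0.
  have := bdiv _ (test_funM (pt n) (pt n)).
  have s1 : smooth1 (p n) by apply: smooth_smooth1; case: (pt n).
  have ti i := trilinear_integrable (bL i) (pdL n i) (ptL n).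
  rewrite (_ : Rintegral _ _ _ = \int[mu]_(x in Omega)
      (2 * \sum_i beta x ord0 i * (partial i (p n) x * p n x))); last first.
    apply: eq_Rintegral_on => x _; rewrite mulr_sumr; apply: eq_bigr => i _.
    by rewrite mxE (partialM i s1 s1); ring.
  have [sE si] := Rintegral_sumr ti.
  rewrite RintegralZl// sE => /eqP; rewrite mulf_eq0 pnatr_eq0 /= => /eqP.
  exact.
have : \sum_i trilinear (fun x => beta x ord0 i) (partial i (p n)) (p n) @[n --> \oo] -->
    \sum_i trilinear (fun x => beta x ord0 i) (fun x => g x ord0 i) v.
  by apply: cvg_sumr => i _; apply: trilinear_cvg.
rewrite (_ : (fun _ => _) = fun=> 0); last by apply/funext => n; exact: zero.
by move=> /(cvg_unique _ (cvg_cst 0)) <-.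
Qed.

End sobolev_theory.

(** * Bilinearity and coercivity of a, and linearity of f, modulo null sets *)

Section bilinear_form.
Context {R : realType} {d : nat} (Omega : set 'rV[R]_d).
Hypotheses (mO : measurable Omega) (finO : (leb d Omega < +oo)%E).
Implicit Types (v w z y : 'rV[R]_d -> R) (g h : 'rV[R]_d -> 'rV[R]_d).
Local Notation lam := (@leb R d).
Local Notation L2 := (inL Omega 2%:E).
Local Notation nrm := (normL Omega 2%:E).

Lemma gradP v : H10 Omega v -> is_H10_grad Omega v (grad Omega v).
Proof. by move=> [g vg]; exact: (xgetPex _ (ex_intro _ g vg)). Qed.

Lemma H10_L2 v : H10 Omega v -> L2 v.
Proof. by move=> /gradP[[]]. Qed.

Lemma grad_L2 v i : H10 Omega v -> L2 (fun x => grad Omega v x ord0 i).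
Proof. by move=> /gradP[[_ + _] _]; exact. Qed.

Lemma H10_lin (c : R) v w z : H10 Omega v -> H10 Omega w ->
  (forall x, Omega x -> z x = c * v x + w x) -> H10 Omega z.
Proof.
by move=> [g vg] [h wh] zE; eexists; exact: (H10_grad_lin mO finO vg wh zE).
Qed.

(** The function -(c v + w) + z vanishes on Omega, and by [H10_grad_lin] the difference of gradients
    is one of its gradients; [H10_grad_null] concludes. *)
Lemma grad_lin_null (c : R) v w z i : H10 Omega v -> H10 Omega w -> H10 Omega z ->
  (forall x, Omega x -> z x = c * v x + w x) ->
  nrm (fun x => grad Omega z x ord0 i -
    (c * grad Omega v x ord0 i + grad Omega w x ord0 i)) = 0.
Proof.
move=> /gradP vg /gradP wg /gradP zg zE.
have lg : is_H10_grad Omega (fun x => c * v x + w x)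
    (fun x => c *: grad Omega v x + grad Omega w x).
  exact: (H10_grad_lin mO finO vg wg).
have := H10_grad_lin mO finO (c := -1) (z := fun x => -1 * (c * v x + w x) + z x) lg zg (fun x _ => erefl).
move=> /H10_grad_null null; rewrite -[RHS](null mO finO _ i).
  by apply: eq_normL => x _; rewrite !mxE; ring.
by move=> x Ox; rewrite zE//; ring.
Qed.

Lemma normL2_eq0 v : (\int[lam]_(x in Omega) (v x ^+ 2)%:E = 0)%E -> nrm v = 0.
Proof.
move=> v0; rewrite /normL unlock (_ : integral _ _ _ = 0%E) /=; first by rewrite powR0// invr_neq0.
rewrite -[RHS]v0 [RHS]integral_mkcond; apply: eq_integral => x _ /=; rewrite !patchE; case: ifPn => _ /=.
  by rewrite powR_mulrn// real_normK ?num_real.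
by rewrite /point /= normr0 powR0.
Qed.

Lemma normH1_null v : H10 Omega v -> (forall x, Omega x -> v x = 0) ->
  normH1 Omega v = 0.
Proof.
move=> vH v0; rewrite /normH1.
have -> : nrm v = 0.
  rewrite normL2_eq0// -[RHS](integral0 lam Omega); apply: eq_integral => x /set_mem Ox.
  by rewrite v0// expr0n.
have g0 i : nrm (fun x => grad Omega v x ord0 i) = 0.
  exact: (H10_grad_null mO finO (gradP vH) v0 i).
rewrite normL2_eq0 ?expr0n ?addr0 ?sqrtr0//.
have gi i : lam.-integrable Omega (EFin \o (fun x => grad Omega v x ord0 i * grad Omega v x ord0 i)).
  by apply: integrable_mul => //; exact: grad_L2.
have [sE si] := Rintegral_sumr mO gi.
rewrite (_ : integral _ _ _ = integral lam Omega (EFin \o (fun x => \sum_i grad Omega v x ord0 i * grad Omega v x ord0 i))).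
  rewrite -[LHS]fineK; last exact: integrable_fin_num.
  rewrite -[fine _]/(Rintegral _ _ _) sE big1// => i _.
  by rewrite -/(ip _ _ _) -normL2_sqr// ?g0 ?expr0n//; exact: grad_L2.
by apply: eq_integral => x _ /=; rewrite sqr_sqrtr// dotv_ge0.
Qed.

(** The definition of [Hm1] gives linearity for the pointwise combination only. Boundedness in the
    H^1 norm removes the dependence on values outside Omega, since the difference has zero norm. *)
Lemma Hm1_lin (f : ('rV[R]_d -> R) -> R) (c : R) v w z : Hm1 Omega f ->
  H10 Omega v -> H10 Omega w -> H10 Omega z ->
  (forall x, Omega x -> z x = c * v x + w x) -> f z = c * f v + f w.
Proof.
move=> [flin [C fC]] vH wH zH zE; rewrite -flin//.
have lH : H10 Omega (fun x => c * v x + w x) by apply: (H10_lin vH wH).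
have eH : H10 Omega (fun x => -1 * (c * v x + w x) + z x) by apply: (H10_lin lH zH).
have := fC _ eH; rewrite normH1_null//; last by move=> x Ox; rewrite zE//; ring.
rewrite mulr0 normr_le0 (flin _ (fun x => c * v x + w x) z)// mulN1r addrC subr_eq0.
by move=> /eqP.
Qed.

Section form_a.
Variables (D : 'rV[R]_d -> 'M[R]_d) (beta : 'rV[R]_d -> 'rV[R]_d) (mu : R).
Hypothesis DL : forall i j, inL Omega +oo%E (fun x => D x i j).
Hypothesis bL : forall i, inL Omega +oo%E (fun x => beta x ord0 i).

Definition diffusion i j w v : R :=
  trilinear Omega (fun x => D x i j) (fun x => grad Omega w x ord0 j) (fun x => grad Omega v x ord0 i).

Definition convection i w v : R :=
  trilinear Omega (fun x => beta x ord0 i) (fun x => grad Omega w x ord0 i) v.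

Lemma form_aE w v : H10 Omega w -> H10 Omega v ->
  form_a Omega D beta mu w v =
    \sum_i \sum_j diffusion i j w v + \sum_i convection i w v + mu * ip Omega w v.
Proof.
move=> wH vH; congr (_ + _ + _).
- have ti i j := trilinear_integrable mO (DL i j) (grad_L2 j wH) (grad_L2 i vH).
  have sE i := Rintegral_sumr mO (ti i).
  under [RHS]eq_bigr do rewrite /diffusion /trilinear -(sE _).1.
  rewrite -(Rintegral_sumr mO (fun i => (sE i).2)).1.
  apply: eq_Rintegral_on => x _; apply: eq_bigr => i _; rewrite !mxE mulr_suml.
  by apply: eq_bigr => j _; rewrite !mxE; ring.
- have ti i := trilinear_integrable mO (bL i) (grad_L2 i wH) (H10_L2 vH).
  rewrite -(Rintegral_sumr mO ti).1.
  apply: eq_Rintegral_on => x _; rewrite mulr_suml; apply: eq_bigr => i _; ring.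
- rewrite -RintegralZl//; last by apply: integrable_mul => //; exact: H10_L2.
  by apply: eq_Rintegral_on => x _; rewrite mulrA.
Qed.

Section linearity.
Variables (c : R) (v w z y : 'rV[R]_d -> R).
Hypotheses (vH : H10 Omega v) (wH : H10 Omega w) (zH : H10 Omega z) (yH : H10 Omega y).
Hypothesis zE : forall x, Omega x -> z x = c * v x + w x.

Let lin_null : nrm (fun x => z x - (c * v x + w x)) = 0.
Proof.
rewrite normL2_eq0// -[RHS](integral0 lam Omega); apply: eq_integral => x /set_mem Ox.
by rewrite zE// subrr expr0n.
Qed.

Lemma diffusion_linl i j : diffusion i j z y = c * diffusion i j v y + diffusion i j w y.
Proof.
exact: (trilinear_lin_null mO (DL i j) (grad_L2 j zH) (grad_L2 j vH) (grad_L2 j wH)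
  (grad_L2 i yH) (grad_lin_null j vH wH zH zE)).
Qed.

Lemma diffusion_linr i j : diffusion i j y z = c * diffusion i j y v + diffusion i j y w.
Proof.
rewrite /diffusion !(trilinearC _ _ (fun x => grad Omega y x ord0 j)).
exact: (trilinear_lin_null mO (DL i j) (grad_L2 i zH) (grad_L2 i vH) (grad_L2 i wH)
  (grad_L2 j yH) (grad_lin_null i vH wH zH zE)).
Qed.

Lemma convection_linl i : convection i z y = c * convection i v y + convection i w y.
Proof.
exact: (trilinear_lin_null mO (bL i) (grad_L2 i zH) (grad_L2 i vH) (grad_L2 i wH)
  (H10_L2 yH) (grad_lin_null i vH wH zH zE)).
Qed.

Lemma convection_linr i : convection i y z = c * convection i y v + convection i y w.
Proof.
rewrite /convection !(trilinearC _ _ (fun x => grad Omega y x ord0 i)).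
exact: (trilinear_lin_null mO (bL i) (H10_L2 zH) (H10_L2 vH) (H10_L2 wH)
  (grad_L2 i yH) lin_null).
Qed.

Let ip_linl : ip Omega z y = c * ip Omega v y + ip Omega w y.
Proof.
rewrite -(ip_lin mO c (H10_L2 vH) (H10_L2 wH) (H10_L2 yH)).
by apply: eq_Rintegral_on => x Ox; rewrite zE.
Qed.

Let lin3 (a1 a2 a3 b1 b2 b3 c1 c2 c3 : R) : a1 = c * b1 + c1 -> a2 = c * b2 + c2 ->
  a3 = c * b3 + c3 -> a1 + a2 + mu * a3 = c * (b1 + b2 + mu * b3) + (c1 + c2 + mu * c3).
Proof. by move=> -> -> ->; ring. Qed.

Lemma form_a_linl :
  form_a Omega D beta mu z y = c * form_a Omega D beta mu v y + form_a Omega D beta mu w y.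
Proof.
rewrite (form_aE zH yH) (form_aE vH yH) (form_aE wH yH).
apply: lin3; last exact: ip_linl.
  rewrite mulr_sumr -big_split; apply: eq_bigr => i _.
  by rewrite mulr_sumr -big_split; apply: eq_bigr => j _; exact: diffusion_linl.
by rewrite mulr_sumr -big_split; apply: eq_bigr => i _; exact: convection_linl.
Qed.

Lemma form_a_linr :
  form_a Omega D beta mu y z = c * form_a Omega D beta mu y v + form_a Omega D beta mu y w.
Proof.
rewrite (form_aE yH zH) (form_aE yH vH) (form_aE yH wH) !(ipC _ y).
apply: lin3; last exact: ip_linl.
  rewrite mulr_sumr -big_split; apply: eq_bigr => i _.
  by rewrite mulr_sumr -big_split; apply: eq_bigr => j _; exact: diffusion_linr.
by rewrite mulr_sumr -big_split; apply: eq_bigr => i _; exact: convection_linr.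
Qed.

End linearity.

(** Convection drops out by [convection_skew] and diffusion is nonnegative by ellipticity. The
    reaction term is kept because [VP_norm_gt0] makes it positive on nonzero nodal vectors. *)
Lemma form_a_ge (d0 : R) v : 0 < d0 -> div_free Omega beta ->
  {ae lam, forall x, Omega x -> forall y : 'rV[R]_d,
     d0 * \sum_i y ord0 i ^+ 2 <= \sum_i \sum_j y ord0 i * D x i j * y ord0 j} ->
  H10 Omega v -> mu * normL Omega 2%:E v ^+ 2 <= form_a Omega D beta mu v v.
Proof.
move=> d00 bdiv ell vH; rewrite (form_aE vH vH) /convection (convection_skew mO finO bL bdiv (gradP vH)) addr0.
rewrite normL2_sqr//; last exact: H10_L2.
rewrite lerDr.
have ti i j := trilinear_integrable mO (DL i j) (grad_L2 j vH) (grad_L2 i vH).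
have sE i := Rintegral_sumr mO (ti i).
under eq_bigr do rewrite /diffusion /trilinear -(sE _).1.
have [<- si] := Rintegral_sumr mO (fun i => (sE i).2).
(* The integrand is nonnegative only almost everywhere, so it is exchanged for its absolute value
   before the sign of the integral is read off. *)
rewrite /Rintegral (@ae_eq_integral _ _ _ lam Omega (abse \o (EFin \o
    (fun x => \sum_i \sum_j D x i j * (grad Omega v x ord0 j * grad Omega v x ord0 i)))))//.
- by rewrite fine_ge0// integral_ge0// => x _; exact: abse_ge0.
- exact: measurable_int si.
- by apply: measurableT_comp => //; exact: measurable_int si.
apply: filterS ell => x ellx Ox /=; rewrite ger0_norm//.
apply: le_trans (_ : _ <= d0 * \sum_i grad Omega v x ord0 i ^+ 2) _.
  by apply: mulr_ge0; [exact: ltW|apply: sumr_ge0 => i _; exact: sqr_ge0].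
apply: le_trans (ellx Ox (grad Omega v x)) _.
rewrite le_eqVlt; apply/orP; left; apply/eqP.
by apply: eq_bigr => i _; apply: eq_bigr => j _; ring.
Qed.

End form_a.
End bilinear_form.

(** * Traces and jumps of discrete functions *)

Section polynomial_functions.
Context {R : realType}.

(** Polynomials by generators instead of coefficients: continuity, partial derivatives, affine
    substitution and boundedness on the reference domain all follow by induction. *)
Inductive polyfun {n : nat} : ('rV[R]_n -> R) -> Prop :=
| polyfun_cst (c : R) : polyfun (fun=> c)
| polyfun_coord (i : 'I_n) : polyfun (fun x => x ord0 i)
| polyfunD p q : polyfun p -> polyfun q -> polyfun (fun x => p x + q x)
| polyfunM p q : polyfun p -> polyfun q -> polyfun (fun x => p x * q x).

Lemma polyfun_sum n (I : Type) (r : seq I) (p : I -> 'rV[R]_n -> R) :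
  (forall i, polyfun (p i)) -> polyfun (fun x => \sum_(i <- r) p i x).
Proof.
move=> pp; elim: r => [|i r IH].
  by rewrite (_ : (fun _ => _) = fun=> 0);
    [exact: polyfun_cst|apply/funext => x; rewrite big_nil].
rewrite (_ : (fun _ => _) = fun x => p i x + \sum_(j <- r) p j x); first exact: polyfunD.
by apply/funext => x; rewrite big_cons.
Qed.

Lemma polyfun_prod n (I : Type) (r : seq I) (p : I -> 'rV[R]_n -> R) :
  (forall i, polyfun (p i)) -> polyfun (fun x => \prod_(i <- r) p i x).
Proof.
move=> pp; elim: r => [|i r IH].
  by rewrite (_ : (fun _ => _) = fun=> 1);
    [exact: polyfun_cst|apply/funext => x; rewrite big_nil].
rewrite (_ : (fun _ => _) = fun x => p i x * \prod_(j <- r) p j x); first exact: polyfunM.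
by apply/funext => x; rewrite big_cons.
Qed.

Lemma polyfunX n (p : 'rV[R]_n -> R) m : polyfun p -> polyfun (fun x => p x ^+ m).
Proof.
move=> pp; elim: m => [|m IH].
  by rewrite (_ : (fun _ => _) = fun=> 1);
    [exact: polyfun_cst|apply/funext => x; rewrite expr0].
rewrite (_ : (fun _ => _) = fun x => p x * p x ^+ m); first exact: polyfunM.
by apply/funext => x; rewrite exprS.
Qed.

Lemma polyfun_lin n (c : R) (p q : 'rV[R]_n -> R) : polyfun p -> polyfun q ->
  polyfun (fun x => c * p x + q x).
Proof. by move=> pp pq; exact: (polyfunD (polyfunM (polyfun_cst c) pp) pq). Qed.

Lemma poly_eval_polyfun n k (c : {ffun 'I_n -> 'I_k.+1} -> R) : polyfun (poly_eval c).
Proof.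
apply: polyfun_sum => m; apply: (polyfunM (polyfun_cst (c m))).
by apply: polyfun_prod => i; apply: polyfunX; exact: polyfun_coord.
Qed.

Lemma polyfun_affine n m (o : 'rV[R]_m) (B : 'M[R]_(n, m)) (p : 'rV[R]_m -> R) :
  polyfun p -> polyfun (fun t : 'rV[R]_n => p (o + t *m B)).
Proof.
elim=> [c|i|{}p q _ pp _ pq|{}p q _ pp _ pq]; first exact: polyfun_cst.
- rewrite (_ : (fun _ => _) = fun t : 'rV[R]_n => o ord0 i + \sum_j t ord0 j * B j i); last first.
    by apply/funext => t; rewrite !mxE.
  apply: (polyfunD (polyfun_cst _)); apply: polyfun_sum => j.
  exact: (polyfunM (polyfun_coord j) (polyfun_cst _)).
- exact: (polyfunD pp pq).
- exact: (polyfunM pp pq).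
Qed.

Lemma polyfun_continuous n (p : 'rV[R]_n -> R) : polyfun p -> continuous p.
Proof.
elim=> [c|i|{}p q _ cp _ cq|{}p q _ cp _ cq].
- exact: continuous_cstr.
- exact: continuous_coord.
- exact: continuous_addr.
- exact: continuous_mulr.
Qed.

Lemma is_derive_coord n (i : 'I_n) (x v : 'rV[R]_n) :
  is_derive x v (fun x : 'rV[R]_n => x ord0 i) (v ord0 i).
Proof.
have lim : h^-1 *: ((h *: v + x) ord0 i - x ord0 i) @[h --> (0 : R)^'] --> v ord0 i.
  apply: cvg_near_cst; near=> h.
  have h0 : h != 0 by near: h; exact: nbhs_dnbhs_neq.
  by rewrite /= !mxE addrK /GRing.scale /= mulKf.
by apply: DeriveDef; [apply/cvg_ex; exists (v ord0 i)|exact: cvg_lim lim].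
Unshelve. all: by end_near. Qed.

(** A single induction for both claims, because the sum and product rules for [partial] presuppose
    [smooth1]. *)
Lemma polyfun_partial n (p : 'rV[R]_n -> R) : polyfun p ->
  smooth1 p /\ forall i, polyfun (partial i p).
Proof.
elim=> [c|i|{}p q _ [p1 pp] _ [q1 pq]|{}p q pp [p1 dp] pq [q1 dq]].
- split=> [|i]; first exact: smooth1_cst.
  by rewrite partial_cst; exact: polyfun_cst.
- split=> [|j].
    by split=> [|j x]; [exact: continuous_coord|case: (is_derive_coord i x (delta_mx ord0 j))].
  rewrite (_ : partial _ _ = fun=> (delta_mx ord0 j : 'rV[R]_n) ord0 i); first exact: polyfun_cst.
  by apply/funext => x; case: (is_derive_coord i x (delta_mx ord0 j)).
- split=> [|i]; first exact: smooth1D.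
  by rewrite (partialD i p1 q1); exact: polyfunD.
- split=> [|i]; first exact: smooth1M.
  rewrite (partialM i p1 q1); exact: (polyfunD (polyfunM (dp i) pq) (polyfunM pp (dq i))).
Qed.

End polynomial_functions.

Section cell_geometry.
Context {R : realType} {d : nat}.
Implicit Types (K : element R d) (v w : 'rV[R]_d -> R).

Let elt_inv K (x : 'rV[R]_d) : 'rV[R]_d := (x - elt_orig K) *m invmx (elt_frame K).

Let elt_mapK K : cancel (elt_map K) (elt_inv K).
Proof. by move=> t; rewrite /elt_inv /elt_map addrC addKr mulmxK// elt_frame_unit. Qed.

Let elt_invK K : cancel (elt_inv K) (elt_map K).
Proof. by move=> x; rewrite /elt_inv /elt_map mulmxKV ?elt_frame_unit// addrC subrK. Qed.

(** The element map is affine, so composing with its inverse turns a mapped polynomial into a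
    polynomial in x; simplices and parallelotopes are alike from here on. *)
Lemma local_space_polyfun k K v : local_space k K v ->
  exists2 q, polyfun q & forall x, cell K x -> v x = q x.
Proof.
rewrite /local_space; case: ifP => Ks [p [c]].
  by move=> [_ ->] vp; exists (poly_eval c) => //; exact: poly_eval_polyfun.
move=> -> vp; exists (fun x => poly_eval c (elt_inv K x)).
  rewrite (_ : (fun _ => _) =
      fun x => poly_eval c (- elt_orig K *m invmx (elt_frame K) + x *m invmx (elt_frame K))).
    exact: polyfun_affine (poly_eval_polyfun c).
  by apply/funext => x; rewrite /elt_inv mulmxDl addrC.
by move=> _ [t tK <-]; rewrite elt_mapK vp// Ks.
Qed.

Lemma local_space_lin k K (c : R) v w z : local_space k K v -> local_space k K w ->
  (forall x, cell K x -> z x = c * v x + w x) -> local_space k K z.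
Proof.
have lin (a b : {ffun 'I_d -> 'I_k.+1} -> R) x :
    c * poly_eval a x + poly_eval b x = poly_eval (fun m => c * a m + b m) x.
  by rewrite /poly_eval mulr_sumr -big_split; apply: eq_bigr => m _ /=; ring.
rewrite /local_space; case: ifP => Ks [p [a pa] vp] [q [b qb] wq] zE.
  exists (poly_eval (fun m => c * a m + b m)).
    exists (fun m => c * a m + b m); split=> // m km.
    by rewrite (pa.1 m km) (qb.1 m km) mulr0 addr0.
  by move=> x Kx; rewrite zE// vp// wq// pa.2 qb.2 lin.
exists (poly_eval (fun m => c * a m + b m)); first by exists (fun m => c * a m + b m).
move=> t tK; rewrite zE; last by exists t; rewrite ?Ks.
by rewrite vp ?Ks// wq ?Ks// pa qb lin.
Qed.

(* Hence the filter of one-sided limits in trace_grad is proper on the cell. *)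
Lemma closure_interior_cell K : cell K `<=` closure (interior (cell K)).
Proof.
pose U := [set t : 'rV[R]_d | (forall i, 0 < t ord0 i) /\
  if is_simplex K as b return Prop then \sum_i t ord0 i < 1 else forall i, t ord0 i < 1].
have cinv i : continuous (fun x => elt_inv K x ord0 i).
  apply: polyfun_continuous.
  rewrite (_ : (fun _ => _) = fun x : 'rV[R]_d =>
    (- elt_orig K *m invmx (elt_frame K) + x *m invmx (elt_frame K)) ord0 i).
    exact: (polyfun_affine _ _ (polyfun_coord i)).
  by apply/funext => x; rewrite /elt_inv mulmxDl addrC.
have oV : open (elt_inv K @^-1` U).
  rewrite openE => x [x0 x1]; rewrite /interior.
  have h0 : \forall y \near x, forall i, 0 < elt_inv K y ord0 i.
    apply: (@filter_forall _ _ (fun i y => 0 < elt_inv K y ord0 i) (nbhs x)) => i.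
    exact: (cvgr_gt _ (cinv i x)).
  have h1 : \forall y \near x,
      if is_simplex K as b return Prop then \sum_i elt_inv K y ord0 i < 1 else forall i, elt_inv K y ord0 i < 1.
    case: (is_simplex K) x1 => x1.
      by apply: (cvgr_lt _ (@continuous_sumr _ _ _ _ _ _ (fun i _ => cinv i) x)).
    apply: (@filter_forall _ _ (fun i y => elt_inv K y ord0 i < 1) (nbhs x)) => i.
    exact: (cvgr_lt _ (cinv i x)).
  by apply: filterS2 h0 h1 => y.
have VK : elt_inv K @^-1` U `<=` interior (cell K).
  move=> x Vx; rewrite /interior.
  have : nbhs x (elt_inv K @^-1` U) by exact: open_nbhs_nbhs.
  apply: filterS => y [y0 y1]; exists (elt_inv K y); last exact: elt_invK.
  split; first by move=> i; exact/ltW.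
  by case: (is_simplex K) y1 => [|y1 i]; exact: ltW.
move=> _ [t [t0 t1] <-] B /nbhs_cubeP[e e0 eB].
set x := elt_map K t in eB *.
(* The point with all coordinates 1/(d+2) is interior to the unit cube and, as d/(d+2) < 1, to the
   unit simplex. The point t is moved towards it. *)
pose a : R := d.+2%:R^-1.
have a0 : 0 < a by rewrite invr_gt0.
have a1 : a < 1 by rewrite invf_lt1// ltr1n.
have da : \sum_(i < d) a < 1.
  by rewrite sumr_const card_ord -mulr_natl ltr_pdivrMr// mul1r ltr_nat ltnS.
pose u : 'rV[R]_d := const_mx a - t.
pose C := `|u *m elt_frame K|.
(* The fraction of the way travelled: s < 1, and s * C < e keeps the image in the cube of radius
   e. *)
pose s := e / (C + 1 + e).
have C0 : 0 <= C by exact: normr_ge0.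
have C1 : 0 < C + 1 by rewrite ltr_wpDl.
have Ce : 0 < C + 1 + e by rewrite addr_gt0.
have s0 : 0 < s by rewrite divr_gt0.
have s1 : s < 1 by rewrite ltr_pdivrMr// mul1r ltrDr.
exists (elt_map K (t + s *: u)); split.
  apply: VK; rewrite /= elt_mapK; split.
    by move=> i; rewrite !mxE; have := t0 i; have : 0 < s * a by [rewrite mulr_gt0]; nra.
  case: (is_simplex K) t1 => t1.
    rewrite (_ : \sum_i _ = (1 - s) * (\sum_i t ord0 i) + s * \sum_(i < d) a).
      nra.
    by rewrite !mulr_sumr -big_split; apply: eq_bigr => i _; rewrite !mxE /=; ring.
  by move=> i; rewrite !mxE; have := t1 i; nra.
apply: eB => i; rewrite /x /elt_map mulmxDl -scalemxAl addrA.
rewrite [X in _ - X]mxE opprD addrA subrr sub0r normrN mxE normrM gtr0_norm//.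
have uC : `|(u *m elt_frame K) ord0 i| <= C.
  by rewrite /C {2}/Num.norm /= mx_normrE (le_bigmax _ (fun i => `|(u *m elt_frame K) i.1 i.2|) (ord0, i)).
apply: le_lt_trans (ler_wpM2l (ltW s0) uC) _.
rewrite /s mulrAC ltr_pdivrMr// ltr_pM2l//; lra.
Qed.

End cell_geometry.

Section facet_integrals.
Context {R : realType} {d : nat}.
Implicit Types (K : element R d) (F : set 'rV[R]_d) (v w g : 'rV[R]_d -> R).

(** The partial derivatives of v and q agree in the interior of the cell, and those of q are
    continuous. The limit is unique because x is in the closure of that interior. *)
Lemma trace_gradE K v q x : polyfun q -> (forall y, cell K y -> v y = q y) ->
  cell K x -> trace_grad v K x = \row_i partial i q x.
Proof.
move=> pq vq Kx; apply/rowP => i; rewrite !mxE.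
have : closure (interior (cell K)) x by exact: closure_interior_cell.
move=> /within_nbhs_proper prop.
apply: cvg_lim => //.
have cq : continuous (partial i q) by apply: polyfun_continuous; case: (polyfun_partial pq).
have h : partial i q y @[y --> within (interior (cell K)) (nbhs x)] --> partial i q x.
  by apply: cvg_trans (cq x); apply: cvg_app; exact: cvg_within.
apply: cvg_trans h; apply: near_eq_cvg.
have wK : within (interior (cell K)) (nbhs x) (interior (cell K)) by exact: withinT.
apply: filterS wK => y Ky /=.
apply/esym/near_eq_derive; have : nbhs y (interior (cell K)).
  by apply: open_nbhs_nbhs; split => //; exact: open_interior.
by apply: filterS => z /interior_subset /vq.
Qed.

Lemma closed_ref_dom n s : closed (ref_dom s : set 'rV[R]_n).
Proof.
have c0 : closed (\bigcap_(i in [set: 'I_n]) ((fun t : 'rV[R]_n => t ord0 i) @^-1` [set y | 0 <= y])).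
  apply: closed_bigI => i _; have /continuous_closedP := @continuous_coord R n i.
  by apply; exact: closed_ge.
have c1 : closed (\bigcap_(i in [set: 'I_n]) ((fun t : 'rV[R]_n => t ord0 i) @^-1` [set y | y <= 1])).
  apply: closed_bigI => i _; have /continuous_closedP := @continuous_coord R n i.
  by apply; exact: closed_le.
have c2 : closed ((fun t : 'rV[R]_n => \sum_i t ord0 i) @^-1` [set y | y <= 1]).
  have /continuous_closedP : continuous (fun t : 'rV[R]_n => \sum_i t ord0 i).
    by apply: continuous_sumr => i _; exact: continuous_coord.
  by apply; exact: closed_le.
case: s.
  have := closedI c0 c2; congr closed; apply/seteqP; split => t [t0 t1]; split => //.
    by move=> i; exact: (t0 i Logic.I).
  by move=> i _; exact: t0.
have := closedI c0 c1; congr closed; apply/seteqP; split => t [t0 t1].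
  by split=> i; [exact: (t0 i Logic.I)|exact: (t1 i Logic.I)].
by split=> i _; [exact: t0|exact: t1].
Qed.

Lemma measurable_ref_dom n s : measurable (ref_dom s : set 'rV[R]_n).
Proof. by apply: closed_measurable_row; exact: closed_ref_dom. Qed.

Lemma ref_dom_le1 n s (t : 'rV[R]_n) : ref_dom s t -> forall i, `|t ord0 i| <= 1.
Proof.
move=> [t0 t1] i; rewrite ger0_norm//; case: s t1 => [t1|]; last exact.
apply: le_trans t1; rewrite (bigD1 i)//= lerDl; exact: sumr_ge0.
Qed.

Lemma polyfun_integrable_ref n s (p : 'rV[R]_n -> R) : polyfun p ->
  (leb n).-integrable (ref_dom s) (EFin \o p).
Proof.
move=> pp; have mr : measurable (ref_dom s : set 'rV[R]_n).
  exact: measurable_ref_dom.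
apply: measurable_bounded_integrable => //.
- apply: leb_bounded => //; exists 1; split; first exact: num_real.
  move=> y y1 t /ref_dom_le1 t1; rewrite /Num.norm /= mx_normrE.
  apply: bigmax_le => [|[a i] _ /=]; first exact: le_trans (ltW y1).
  by rewrite (ord1 a) (le_trans (t1 i))// ltW.
- by apply: measurable_funTS; apply: continuous_measurable_row; exact: polyfun_continuous.
have [C pC] : exists C : R, forall t, ref_dom s t -> `|p t| <= C.
  elim: pp => [c|i|{}p q _ [C1 h1] _ [C2 h2]|{}p q _ [C1 h1] _ [C2 h2]].
  - by exists `|c|.
  - by exists 1 => t /ref_dom_le1; exact.
  - exists (C1 + C2) => t ts; apply: le_trans (ler_normD _ _) _.
    by rewrite lerD ?h1 ?h2.
  - by exists (C1 * C2) => t ts; rewrite normrM ler_pM ?h1 ?h2.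
exists C; split; first exact: num_real.
by move=> y Cy t ts; apply: le_trans (pC t ts) _; exact: ltW.
Qed.

Definition polyfun_on F g := exists2 q, polyfun q & forall x, F x -> g x = q x.

Lemma chart_of_map F t : (exists c, is_chart F c) -> ref_dom (chart_of F).1 t ->
  F (chart_map (chart_of F) t).
Proof.
move=> Fc tr; have [_ FE] : is_chart F (chart_of F) by exact: (xgetPex _ Fc).
by rewrite [X in X (chart_map _ _)]FE; exists t.
Qed.

Lemma polyfun_on_integrable F g : (exists c, is_chart F c) -> polyfun_on F g ->
  (leb d.-1).-integrable (ref_dom (chart_of F).1)
    (EFin \o (fun t => g (chart_map (chart_of F) t))).
Proof.
move=> Fc [q pq gq]; have pc := polyfun_affine (chart_of F).2.1 (chart_of F).2.2 pq.
apply: eq_integrable (polyfun_integrable_ref (chart_of F).1 pc).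
  exact: measurable_ref_dom.
by move=> t /set_mem tr /=; rewrite gq//; exact: chart_of_map.
Qed.

(** Additivity of the integral requires integrable terms; polynomials on the compact reference
    domain provide them. *)
Lemma surf_int_lin F (c : R) v w z : (exists c, is_chart F c) ->
  polyfun_on F v -> polyfun_on F w -> (forall x, F x -> z x = c * v x + w x) ->
  surf_int F z = c * surf_int F v + surf_int F w.
Proof.
move=> Fc pv pw zE; rewrite /surf_int mulrCA -mulrDr; congr (_ * _).
rewrite -Rintegral_lin; [|exact: measurable_ref_dom|exact: polyfun_on_integrable..].
by apply: eq_Rintegral_on => t tr; rewrite zE//; exact: chart_of_map.
Qed.

Lemma surf_int_ge0 F g : (forall x, 0 <= g x) -> 0 <= surf_int F g.
Proof. by move=> g0; rewrite mulr_ge0 ?sqrtr_ge0// Rintegral_ge0. Qed.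

End facet_integrals.

(** * Bilinearity and nonnegativity of J *)

Section jump_form.
Context {R : realType} {d : nat} (Omega : set 'rV[R]_d).
Variables (M : nat) (T : 'I_M -> element R d) (k : nat).
Hypothesis TP : conforming_partition Omega T.
Variables (beta : 'rV[R]_d -> 'rV[R]_d) (gamma : R).
Implicit Types (v w z y : 'rV[R]_d -> R).

Lemma cell_closure i x : cell (T i) x -> closure Omega x.
Proof. by case: TP => -> _ _ ix; exists i. Qed.

Lemma trace_grad_lin i (c : R) v w z x : local_space k (T i) v -> local_space k (T i) w ->
  (forall x, closure Omega x -> z x = c * v x + w x) -> cell (T i) x ->
  trace_grad z (T i) x = c *: trace_grad v (T i) x + trace_grad w (T i) x.
Proof.
move=> /local_space_polyfun[p pp vp] /local_space_polyfun[q pq wq] zE ix.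
rewrite (trace_gradE pp vp ix) (trace_gradE pq wq ix).
rewrite (@trace_gradE _ _ _ z (fun x => c * p x + q x) x (polyfun_lin c pp pq) _ ix).
  have [[p1 _] [q1 _]] := (polyfun_partial pp, polyfun_partial pq).
  by apply/rowP => l; rewrite !mxE (partial_lin l c p1 q1).
by move=> y iy; rewrite zE ?vp ?wq//; exact: cell_closure iy.
Qed.

Lemma jump_grad_lin i j (c : R) v w z x :
  (forall i, local_space k (T i) v) -> (forall i, local_space k (T i) w) ->
  (forall x, closure Omega x -> z x = c * v x + w x) ->
  (cell (T i) `&` cell (T j)) x ->
  jump_grad T i j z x = c *: jump_grad T i j v x + jump_grad T i j w x.
Proof.
move=> vT wT zE [ix jx]; rewrite /jump_grad.
rewrite (trace_grad_lin (vT i) (wT i) zE ix) (trace_grad_lin (vT j) (wT j) zE jx).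
move: (trace_grad v _ x) (trace_grad v _ x) (trace_grad w _ x) (trace_grad w _ x) => a b a' b'.
by apply/rowP => l; rewrite !mxE; ring.
Qed.

Lemma jump_grad_polyfun i j v l : (forall i, local_space k (T i) v) ->
  polyfun_on (cell (T i) `&` cell (T j)) (fun x => jump_grad T i j v x ord0 l).
Proof.
move=> vT; have [p pp vp] := local_space_polyfun (vT i).
have [q pq vq] := local_space_polyfun (vT j).
exists (fun x => -1 * partial l q x + partial l p x).
  by apply: polyfun_lin; [case: (polyfun_partial pq)|case: (polyfun_partial pp)].
move=> x [ix jx]; rewrite /jump_grad (trace_gradE pp vp ix) (trace_gradE pq vq jx) !mxE.
by rewrite mulN1r addrC.
Qed.

(** Here [a] stands for the weight of a facet in J, which does not vary along the facet, so that the
    whole integrand is a polynomial there. *)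
Lemma jump_term_polyfun i j (a : R) v w :
  (forall i, local_space k (T i) v) -> (forall i, local_space k (T i) w) ->
  polyfun_on (cell (T i) `&` cell (T j))
    (fun x => a * dotv (jump_grad T i j v x) (jump_grad T i j w x)).
Proof.
have coef u : (forall i, local_space k (T i) u) -> exists p : 'I_d -> 'rV[R]_d -> R,
    forall l, polyfun (p l) /\
      forall x, (cell (T i) `&` cell (T j)) x -> jump_grad T i j u x ord0 l = p l x.
  move=> uT; have h l : exists p, polyfun p /\
      forall x, (cell (T i) `&` cell (T j)) x -> jump_grad T i j u x ord0 l = p x.
    by have [p pp pE] := jump_grad_polyfun i j l uT; exists p.
  by have [p pP] := choice h; exists p.
move=> /coef[p pP] /coef[q qP].
exists (fun x => a * \sum_l p l x * q l x).
  apply: (polyfunM (polyfun_cst a)); apply: polyfun_sum => l.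
  exact: (polyfunM (pP l).1 (qP l).1).
move=> x Fx; rewrite /dotv; congr (a * _); apply: eq_bigr => l _.
exact: (congr2 *%R ((pP l).2 x Fx) ((qP l).2 x Fx)).
Qed.

Let weighted_dotv_linl (a c : R) (r s t u : 'rV[R]_d) : r = c *: s + t ->
  a * dotv r u = c * (a * dotv s u) + a * dotv t u.
Proof. by move=> ->; rewrite dotvDl dotvZl; ring. Qed.

Let weighted_dotv_linr (a c : R) (r s t u : 'rV[R]_d) : r = c *: s + t ->
  a * dotv u r = c * (a * dotv u s) + a * dotv u t.
Proof. by move=> ->; rewrite dotvDr dotvZr; ring. Qed.

Lemma form_J_linl (c : R) v w z y :
  (forall i, local_space k (T i) v) -> (forall i, local_space k (T i) w) ->
  (forall i, local_space k (T i) y) ->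
  (forall x, closure Omega x -> z x = c * v x + w x) ->
  form_J T beta gamma z y = c * form_J T beta gamma v y + form_J T beta gamma w y.
Proof.
move=> vT wT yT zE; rewrite /form_J mulrCA -mulrDr; congr (_ * _).
rewrite mulr_sumr -big_split; apply: eq_bigr => i _.
rewrite mulr_sumr -big_split; apply: eq_bigr => j /andP[_ /asboolP[[_ Fc] _]] /=.
apply: surf_int_lin => //; [exact: jump_term_polyfun|exact: jump_term_polyfun|].
by move=> x Fx; exact: weighted_dotv_linl (jump_grad_lin vT wT zE Fx).
Qed.

Lemma form_J_linr (c : R) v w z y :
  (forall i, local_space k (T i) v) -> (forall i, local_space k (T i) w) ->
  (forall i, local_space k (T i) y) ->
  (forall x, closure Omega x -> z x = c * v x + w x) ->
  form_J T beta gamma y z = c * form_J T beta gamma y v + form_J T beta gamma y w.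
Proof.
move=> vT wT yT zE; rewrite /form_J mulrCA -mulrDr; congr (_ * _).
rewrite mulr_sumr -big_split; apply: eq_bigr => i _.
rewrite mulr_sumr -big_split; apply: eq_bigr => j /andP[_ /asboolP[[_ Fc] _]] /=.
apply: surf_int_lin => //; [exact: jump_term_polyfun|exact: jump_term_polyfun|].
by move=> x Fx; exact: weighted_dotv_linr (jump_grad_lin vT wT zE Fx).
Qed.

Lemma form_J_ge0 v : 0 <= gamma -> 0 <= form_J T beta gamma v v.
Proof.
move=> g0; apply: mulr_ge0 => //; apply: sumr_ge0 => i _; apply: sumr_ge0 => j _ /=.
apply: surf_int_ge0 => x; apply: mulr_ge0; last exact: dotv_ge0.
by apply: mulr_ge0; [exact: normL_ge0|exact: sqr_ge0].
Qed.

End jump_form.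

(** * The finite element space *)

Section finite_element_space.
Context {R : realType} {d : nat} (Omega : set 'rV[R]_d).
Variables (M : nat) (T : 'I_M -> element R d) (k : nat).
Hypotheses (oO : open Omega) (bO : bounded_set Omega).
Implicit Types (v w z : 'rV[R]_d -> R).
Local Notation lam := (@leb R d).
Local Notation V := (VP Omega T k).

Let mO : measurable Omega. Proof. exact: open_measurable_row. Qed.
Let finO : (leb d Omega < +oo)%E. Proof. exact: leb_bounded. Qed.

Lemma H10_0 : H10 Omega (fun=> 0 : R).
Proof.
have z0 u : (forall x, u x = 0) -> normL Omega 2%:E u = 0.
  move=> u0; rewrite normL2_eq0// -[RHS](integral0 lam Omega).
  by apply: eq_integral => x _; rewrite u0 expr0n.
have ip0 u w : (forall x, u x = 0) -> ip Omega u w = 0.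
  move=> u0; rewrite -[RHS](mul0r (fine (lam Omega))) -(Rintegral_cst lam mO).
  by apply: eq_Rintegral_on => x _; rewrite u0 mul0r.
have s0 : [set x : 'rV[R]_d | (0 : R) != 0] = set0.
  by apply/seteqP; split => x //=; rewrite eqxx.
exists (fun=> 0); split.
  split; first exact: inL2_0.
    by move=> i; rewrite (_ : (fun _ => _) = fun=> 0); [exact: inL2_0|apply/funext => x; rewrite mxE].
  move=> psi _ i; rewrite (ip0 (fun=> 0))// (ip0 (fun x => (0 : 'rV[R]_d) ord0 i)) ?oppr0//.
  by move=> x; rewrite mxE.
exists (fun _ _ => 0); split.
- move=> _; split; first exact: smooth_cst.
    by rewrite s0 closure0; exact: compact0.
  by rewrite s0 closure0.
- rewrite (_ : (fun _ => _) = fun=> 0); first exact: cvg_cst.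
  by apply/funext => n; rewrite z0// => x; rewrite subrr.
move=> i; rewrite (_ : (fun _ => _) = fun=> 0); first exact: cvg_cst.
by apply/funext => n; rewrite z0// => x; rewrite partial_cst mxE subrr.
Qed.

Lemma VP_0 : V (fun=> 0).
Proof.
split; [exact: continuous_cstr| |exact: H10_0].
have p0 : (fun=> 0) = poly_eval (fun=> 0) :> ('rV[R]_d -> R).
  by move=> n; apply/funext => t; rewrite /poly_eval big1// => m _; rewrite mul0r.
move=> i; rewrite /local_space; case: ifP => _; exists (fun=> 0) => //.
  by exists (fun=> 0); split.
by exists (fun=> 0).
Qed.

Lemma VP_lin (c : R) v w : V v -> V w -> V (fun x => c * v x + w x).
Proof.
move=> [cv lv vH] [cw lw wH]; split.
- apply: continuous_addr => //; apply: continuous_mulr => //; exact: continuous_cstr.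
- by move=> i; apply: local_space_lin (lv i) (lw i) _.
- exact: (H10_lin mO finO vH wH).
Qed.

Lemma VP_sum (I : Type) (r : seq I) (c : I -> R) (p : I -> 'rV[R]_d -> R) :
  (forall i, V (p i)) -> V (fun x => \sum_(i <- r) c i * p i x).
Proof.
move=> pV; elim: r => [|i r IH].
  by rewrite (_ : (fun _ => _) = fun=> 0);
    [exact: VP_0|apply/funext => x; rewrite big_nil].
rewrite (_ : (fun _ => _) = fun x => c i * p i x + \sum_(j <- r) c j * p j x).
  exact: VP_lin.
by apply/funext => x; rewrite big_cons.
Qed.

(** Agreement is asked on the closure only, as in [lagrange_basis]. The notion covers [f] and both
    arguments of a_J, so one expansion lemma serves all three. *)
Definition linear_on_VP (L : ('rV[R]_d -> R) -> R) : Prop :=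
  forall (c : R) v w z, V v -> V w -> V z ->
    (forall x, closure Omega x -> z x = c * v x + w x) -> L z = c * L v + L w.

Lemma linear_on_VP_sum L (I : Type) (r : seq I) (c : I -> R) (p : I -> 'rV[R]_d -> R) v :
  linear_on_VP L -> (forall i, V (p i)) -> V v ->
  (forall x, closure Omega x -> v x = \sum_(i <- r) c i * p i x) ->
  L v = \sum_(i <- r) c i * L (p i).
Proof.
move=> Llin pV; elim: r v => [|i r IH] v vV vE.
  (* For the empty sum v vanishes on the closure, so v = (-1) v + v there and L v = - L v + L v =
     0. *)
  rewrite big_nil (Llin (-1) v v v)//; first by rewrite mulN1r addNr.
  by move=> x Ox; rewrite vE// big_nil mulr0 addr0.
rewrite big_cons -(IH (fun x => \sum_(j <- r) c j * p j x))//; last exact: VP_sum.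
apply: Llin => //; first exact: VP_sum.
by move=> x Ox; rewrite vE// big_cons.
Qed.

(** By continuity |v| exceeds |v y| / 2 on a cube around y contained in Omega, and cubes have
    positive measure. *)
Lemma VP_norm_gt0 v y : V v -> Omega y -> v y != 0 -> 0 < normL Omega 2%:E v.
Proof.
move=> [/subspace_continuousP cv _ vH] Oy vy0; have vL := H10_L2 vH.
rewrite -(@ltr_pXn2r _ 2) ?nnegrE ?normL_ge0// expr0n /= normL2_sqr//.
pose m := `|v y| / 2; have m0 : 0 < m by rewrite divr_gt0// normr_gt0.
have nv : \forall z \near y, Omega z /\ m < `|v z|.
  have h0 : \forall z \near y, Omega z by exact: open_nbhs_nbhs.
  have h1 : \forall z \near within (closure Omega) (nbhs y), m < `|v z|.
    apply: (cvgr_gt _ (cvg_norm (cv y (subset_closure Oy)))).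
    by rewrite /m ltr_pdivrMr// ltr_pMr ?normr_gt0// ltr1n.
  by apply: filterS2 h0 h1 => z Oz mz; split => //; apply: mz; exact: subset_closure.
have /nbhs_cubeP[e e0 eP] := nv.
have mC := measurable_cube y e.
have le : ((m ^+ 2)%:E * leb d (cube y e) <= \int[lam]_(z in Omega) (v z * v z)%:E)%E.
  apply: (@le_trans _ _ (\int[lam]_(z in cube y e) (v z * v z)%:E)%E).
    rewrite -integral_cst//; apply: ge0_le_integral => //.
    - by move=> z _; rewrite lee_fin sqr_ge0.
    - apply/measurable_EFinP; apply: (measurable_funS mO); first by move=> z /eP[].
      by apply: measurable_funM; exact: (inL_measurable mO vL).
    - move=> z /eP[_ mz]; rewrite lee_fin -expr2 -[leRHS]real_normK ?num_real//.
      by rewrite ler_sqr ?nnegrE ?(ltW m0)// ltW.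
  apply: ge0_subset_integral => //.
  - by apply/measurable_EFinP; apply: measurable_funM; exact: (inL_measurable mO vL).
  - by move=> z _; rewrite lee_fin -expr2 sqr_ge0.
  - by move=> z /eP[].
apply: fine_gt0; rewrite (lt_le_trans _ le) ?mule_gt0 ?lte_fin ?exprn_gt0 ?leb_cube_gt0//=.
by rewrite ltey_eq (integrable_fin_num mO (integrable_mul mO vL vL)).
Qed.

End finite_element_space.

(** * The discrete scheme as a truncated system for nodal values *)

Unset Implicit Arguments.

Theorem theorem3p4 (R : realType) (d : nat) (d23 : d = 2%N \/ d = 3%N)
  (Omega : set 'rV[R]_d) (OmegaP : lipschitz_polyhedral_domain Omega)
  (f : ('rV[R]_d -> R) -> R) (fP : Hm1 Omega f)
  (D : 'rV[R]_d -> 'M[R]_d) (d0 : R)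
  (D_Loo : forall i j, inL Omega +oo%E (fun x => D x i j))
  (D_sym : {ae leb d, forall x, Omega x -> (D x)^T = D x})
  (d0_gt0 : 0 < d0)
  (D_ell : {ae leb d, forall x, Omega x -> forall y : 'rV[R]_d,
     d0 * \sum_i y ord0 i ^+ 2 <=
       \sum_i \sum_j y ord0 i * D x i j * y ord0 j})
  (beta : 'rV[R]_d -> 'rV[R]_d)
  (beta_Loo : forall i, inL Omega +oo%E (fun x => beta x ord0 i))
  (beta_div : div_free Omega beta)
  (mu kappa : R) (mu_gt0 : 0 < mu) (kappa_gt0 : 0 < kappa)
  (M : nat) (T : 'I_M -> element R d) (TP : conforming_partition Omega T)
  (sigma tau : R) (T_shape : shape_regular T sigma) (T_qu : quasi_uniform T tau)
  (beta_facet : forall (i : 'I_M) F, is_facet F (cell (T i)) ->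
     (forall l, inLoo_facet F (fun x => beta x ord0 l)) /\
     normLoo_facet F (fun x => enorm (beta x)) <=
       normL (cell (T i)) +oo%E (fun x => enorm (beta x)))
  (hh : 'rV[R]_d -> R) (hhP : mesh_function Omega T hh)
  (k : nat) (k_ge1 : (1 <= k)%N) (N : nat) (x : 'I_N -> 'rV[R]_d)
  (xP : internal_nodes Omega T k x)
  (phi : 'I_N -> 'rV[R]_d -> R) (phiP : lagrange_basis Omega T k x phi)
  (gamma alpha Cequiv : R) (gamma_ge0 : 0 <= gamma) (alpha_gt0 : 0 < alpha)
  (Cequiv_gt0 : 0 < Cequiv)
  (CequivP : forall alpha0 : R, 0 < alpha0 -> forall v, VP Omega T k v ->
     norm_h Omega T D beta mu gamma v ^+ 2 <=
       Cequiv / alpha0 * form_s T D beta mu alpha0 hh x v v)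
  (alpha_ge : Cequiv <= alpha) :
  exists u, VP Omega T k u /\
    forall v, VP Omega T k v ->
      form_aJ Omega T D beta mu gamma (pos_part kappa x phi u) v +
      form_s T D beta mu alpha hh x (neg_part kappa x phi u) v = f v.
Proof.
have [[oO _] _ bO _ _] := OmegaP.
have mO : measurable Omega by exact: open_measurable_row.
have finO : (leb d Omega < +oo)%E by exact: leb_bounded.
have [phiV phix basis] := phiP.
have xO i : Omega (x i).
  have : range x (x i) by exists i.
  by case: xP => _ -> [].
have xcl i : closure Omega (x i) by exact: subset_closure.
have cl y : Omega y -> closure Omega y by exact: subset_closure.
set V := VP Omega T k in basis phiV *.
pose comb (c : 'I_N -> R) : 'rV[R]_d -> R := fun y => \sum_i c i * phi i y.
have combV c : V (comb c) by exact: VP_sum.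
have combx c j : comb c (x j) = c j.
  rewrite /comb (bigD1 j)//= phix eqxx mulr1 big1 ?addr0// => i ij.
  by rewrite phix (negbTE ij) mulr0.
have add_lin (c a1 a2 a3 j1 j2 j3 : R) : a1 = c * a2 + a3 -> j1 = c * j2 + j3 ->
    a1 + j1 = c * (a2 + j2) + (a3 + j3) by move=> -> ->; ring.
pose aJ := form_aJ Omega T D beta mu gamma.
have aJl y : V y -> linear_on_VP Omega T k (fun v => aJ v y).
  move=> [_ yT yH] c v w z [_ vT vH] [_ wT wH] [_ zT zH] zE.
  exact: (add_lin _ _ _ _ _ _ _
    (form_a_linl mO finO mu D_Loo beta_Loo vH wH zH yH (fun x Ox => zE x (cl x Ox)))
    (form_J_linl TP beta gamma vT wT yT zE)).
have aJr y : V y -> linear_on_VP Omega T k (fun v => aJ y v).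
  move=> [_ yT yH] c v w z [_ vT vH] [_ wT wH] [_ zT zH] zE.
  exact: (add_lin _ _ _ _ _ _ _
    (form_a_linr mO finO mu D_Loo beta_Loo vH wH zH yH (fun x Ox => zE x (cl x Ox)))
    (form_J_linr TP beta gamma vT wT yT zE)).
have flin : linear_on_VP Omega T k f.
  move=> c v w z [_ _ vH] [_ _ wH] [_ _ zH] zE.
  exact: (Hm1_lin mO finO fP vH wH zH (fun x Ox => zE x (cl x Ox))).
pose A i j := aJ (phi j) (phi i).
pose b i := f (phi i).
pose coef i := normL (patch_of T (x i)) +oo%E (fun y => opnorm (D y)) * hh (x i) ^+ (d - 2)%N +
     normL (patch_of T (x i)) +oo%E (fun y => enorm (beta y)) * hh (x i) ^+ (d - 1)%N +
     mu * hh (x i) ^+ d.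
have sE v w : form_s T D beta mu alpha hh x v w = alpha * \sum_i coef i * v (x i) * w (x i) by [].
(* The equivalence bound for phi_i itself forces its weight to be positive. *)
have s_gt0 i : 0 < alpha * coef i.
  have sii : form_s T D beta mu alpha hh x (phi i) (phi i) = alpha * coef i.
    rewrite sE (bigD1 i)//= phix eqxx !mulr1 big1 ?addr0// => j ji.
    by rewrite phix eq_sym (negbTE ji) mulr0.
  (* The reaction part of [norm_h] carries sqrt(mu) inside the norm, so positivity is needed for the
     scaled basis function. *)
  have muphiV : V (fun y => Num.sqrt mu * phi i y).
    have := VP_lin oO bO (Num.sqrt mu) (phiV i) (VP_0 T k oO).
    by congr V; apply/funext => y; rewrite addr0.
  have nphi : 0 < normL Omega 2%:E (fun y => Num.sqrt mu * phi i y).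
    apply: (VP_norm_gt0 oO muphiV (xO i)).
    by rewrite phix eqxx mulr1 gt_eqF// sqrtr_gt0.
  have J_ge := form_J_ge0 T beta (phi i) gamma_ge0.
  have := CequivP alpha alpha_gt0 (phi i) (phiV i); rewrite sii.
  have n_gt0 : 0 < norm_h Omega T D beta mu gamma (phi i) ^+ 2.
    rewrite exprn_gt0// sqrtr_gt0; apply: ltr_wpDr J_ge _.
    by apply: ltr_wpDl (sqr_ge0 _) _; rewrite exprn_gt0.
  by move=> /(lt_le_trans n_gt0); rewrite pmulr_rgt0// divr_gt0.
(* The quadratic form of [A] at c is a_J(v, v) for the function v with nodal vector c. *)
have A_pos (c : 'rV[R]_N) : c != 0 -> 0 < \sum_i \sum_j A i j * c ord0 j * c ord0 i.
  move=> c0; pose v := comb (fun i => c ord0 i).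
  have vV : V v by exact: combV.
  have -> : \sum_i \sum_j A i j * c ord0 j * c ord0 i = aJ v v.
    rewrite (linear_on_VP_sum oO bO (aJr v vV) phiV vV (fun _ _ => erefl)).
    apply: eq_bigr => i _.
    rewrite (linear_on_VP_sum oO bO (aJl (phi i) (phiV i)) phiV vV (fun _ _ => erefl)).
    by rewrite mulr_sumr; apply: eq_bigr => j _; rewrite /A; ring.
  have [i ci] : exists i, c ord0 i != 0.
    apply: contrapT => nc; move/eqP : c0; apply; apply/rowP => i; rewrite mxE.
    by apply/eqP/negPn/negP => ci; apply: nc; exists i.
  have vn : 0 < normL Omega 2%:E v.
    by apply: (VP_norm_gt0 oO vV (xO i)); rewrite /v combx.
  have [_ _ vH] := vV.
  have a_ge := form_a_ge mO finO mu D_Loo beta_Loo d0_gt0 beta_div D_ell vH.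
  have J_ge := form_J_ge0 T beta v gamma_ge0.
  have mu_v : 0 < mu * normL Omega 2%:E v ^+ 2 by rewrite mulr_gt0// exprn_gt0.
  exact: ltr_wpDr J_ge (lt_le_trans mu_v a_ge).
have [U UE] := clip_system b kappa_gt0 s_gt0 A_pos.
pose u := comb U; pose p := comb (fun i => clip kappa (U i)).
have pE : pos_part kappa x phi u = p.
  by apply/funext => y; apply: eq_bigr => i _; rewrite /u combx.
exists u; split=> [|v vV]; first exact: combV.
(* Testing with v sums the equations of [UE] with weights c i, the nodal values of v; the
   stabilization, diagonal in nodal values, contributes s_i (U_i - clip U_i) c_i. *)
have [c cE] := basis v vV.
have vx i : v (x i) = c i by rewrite cE// -[RHS](combx c).
rewrite pE -/aJ (linear_on_VP_sum oO bO (aJr p (combV _)) phiV vV cE).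
rewrite (linear_on_VP_sum oO bO flin phiV vV cE) sE mulr_sumr -big_split.
apply: eq_bigr => i _ /=.
rewrite (linear_on_VP_sum oO bO (aJl (phi i) (phiV i)) phiV (combV _) (fun _ _ => erefl)).
rewrite /neg_part pE /u /p !combx vx -/(b i) -(UE i) -/(A i _).
rewrite (_ : \sum_j _ = \sum_j A i j * clip kappa (U j)).
  ring.
by apply: eq_bigr => j _; rewrite mulrC.
Qed.
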